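(* For each natural number $k$ let $\alpha_k$ be a finitely generated $k$-fold symmetric tensor norm, and let $\mathfrak A_k^{max}$ and $\mathfrak A_k^{min}$ be the maximal and minimal polynomial ideals associated to $\alpha_k$. For natural numbers $k,l$ and fixed $c_{k,l}>0$, the following assertions are equivalent. (i) For every Banach space $E$, if $P\in\mathfrak A_k^{max}(E)$ and $Q\in\mathfrak A_l^{max}(E)$, then $PQ\in\mathfrak A_{k+l}^{max}(E)$ and $\|PQ\|_{\mathfrak A_{k+l}^{max}(E)}\le c_{k,l}\|P\|_{\mathfrak A_k^{max}(E)}\|Q\|_{\mathfrak A_l^{max}(E)}$. (ii) For every Banach space $E$, if $P\in\mathfrak A_k^{min}(E)$ and $Q\in\mathfrak A_l^{min}(E)$, then $PQ\in\mathfrak A_{k+l}^{min}(E)$ and $\|PQ\|_{\mathfrak A_{k+l}^{min}(E)}\le c_{k,l}\|P\|_{\mathfrak A_k^{min}(E)}\|Q\|_{\mathfrak A_l^{min}(E)}$. (iii) For every Banach space $E$, if $s\in\otimes^{k,s}_{\alpha_k}E'$ and $t\in\otimes^{l,s}_{\alpha_l}E'$, then $\alpha_{k+l}(\sigma(s\otimes t))\le c_{k,l}\,\alpha_k(s)\,\alpha_l(t)$.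
   Context: All Banach spaces are complex. $\mathcal P^k(E)$ is the Banach space of continuous $k$-homogeneous polynomials $E\to\mathbb C$. $\otimes^{k,s}E$ is the $k$-fold symmetric tensor product (the span of the tensors $x\otimes\cdots\otimes x$ in $\otimes^kE$), written $\otimes^{k,s}_{\alpha_k}E$ when endowed with the norm $\alpha_k$; $\sigma:\otimes^mE\to\otimes^{m,s}E$ is the symmetrization operator, $\sigma(x_1\otimes\cdots\otimes x_m)=\frac1{m!}\sum_{\eta}x_{\eta(1)}\otimes\cdots\otimes x_{\eta(m)}$, sum over permutations $\eta$ of $\{1,\dots,m\}$. A $k$-fold symmetric tensor norm $\alpha_k$ assigns to each normed space $E$ a norm on $\otimes^{k,s}E$ such that $\alpha_k(1\otimes\cdots\otimes1)=1$ on $\otimes^{k,s}\mathbb C$ and the metric mapping property holds: $\|\otimes^kT\|\le\|T\|^k$ for $T\in\mathcal L(E,F)$. It is finitely generated if $\alpha_k(s,\otimes^{k,s}E)=\inf\{\alpha_k(s,\otimes^{k,s}N):N\subset E \text{ finite dimensional},\ s\in\otimes^{k,s}N\}$. The maximal ideal associated to $\alpha_k$ is $\mathfrak A_k^{max}(E)=\{P\in\mathcal P^k(E):\|P\|_{\mathfrak A_k^{max}(E)}=\sup_N\|P|_N\|_{(\otimes^{k,s}N',\alpha_k)}<\infty\}$, supremum over finite dimensional subspaces $N\subset E$, where $\mathcal P^k(N)$ is identified with $\otimes^{k,s}N'$ by $\gamma^k\leftrightarrow\gamma\otimes\cdots\otimes\gamma$. The minimal ideal associated to $\alpha_k$ is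 $\mathfrak A_k^{min}=\mathfrak A_k^{max}\circ\overline{\mathcal F}$, with $\overline{\mathcal F}$ the ideal of approximable operators (operator norm closure of finite rank operators): $P\in\mathfrak A_k^{min}(E)$ iff $P=Q\circ T$ with $T\in\overline{\mathcal F}(E,E_1)$, $Q\in\mathfrak A_k^{max}(E_1)$ for some Banach space $E_1$, with norm $\inf\|Q\|_{\mathfrak A_k^{max}(E_1)}\|T\|^k$ over all such factorizations. *)

(* Defs.v *)
From HB Require Import structures.
From mathcomp Require Import all_boot all_order all_algebra perm complex.
From mathcomp Require Import all_classical all_reals all_analysis.

Set Implicit Arguments.
Unset Strict Implicit.
Unset Printing Implicit Defensive.

Import Order.TTheory GRing.Theory Num.Theory numFieldNormedType.Exports.

Local Open Scope classical_set_scope.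
Local Open Scope ring_scope.
Local Open Scope complex_scope.

Section LinearSpan.
Variables (K : pzRingType) (V : lmodType K).

Definition lspan (S : set V) : set V :=
  [set v | exists n (c : 'I_n -> K) (w : 'I_n -> V),
     (forall i, S (w i)) /\ v = \sum_(i < n) c i *: w i].

Lemma lspan_gen (S : set V) v : S v -> lspan S v.
Proof.
move=> Sv; exists 1%N, (fun=> 1), (fun=> v); split=> //.
by rewrite big_ord1 scale1r.
Qed.

Lemma lspan0 (S : set V) : lspan S 0.
Proof. by exists 0%N, (fun=> 0), (fun=> 0); split; [case|rewrite big_ord0]. Qed.

Lemma lspanP (S : set V) a u v : lspan S u -> lspan S v -> lspan S (a *: u + v).
Proof.
move=> [m [c [x [Sx ->]]]] [n [d [y [Sy ->]]]].
exists (m + n)%N.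
exists (fun i : 'I_(m + n) => match fintype.split i with inl j => a * c j | inr j => d j end).
exists (fun i : 'I_(m + n) => match fintype.split i with inl j => x j | inr j => y j end).
split=> [i|]; first by case: fintype.split.
rewrite big_split_ord /= scaler_sumr; congr (_ + _); apply: eq_bigr => i _.
  by rewrite -/(unsplit (inl i)) unsplitK scalerA.
by rewrite -/(unsplit (inr i)) unsplitK.
Qed.

Lemma lspan_ind (S W : set V) : W 0 ->
  (forall a u v, S u -> W v -> W (a *: u + v)) -> lspan S `<=` W.
Proof.
move=> W0 Wl v [n [c [x [Sx ->]]]]; elim/big_rec: _ => // i u _ Wu.
exact: Wl.
Qed.

End LinearSpan.

Section RealNorm.
Variable R : realType.

(* The library norm of a complex normed space has its values in [R[i]]. *)
Definition rnorm (E : normedModType R[i]) (x : E) : R := complex.Re `|x|.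

Lemma rnormE (E : normedModType R[i]) (x : E) : `|x| = (rnorm x)%:C.
Proof.
have := normr_ge0 x; rewrite /rnorm; case: (`|x|) => a b /=.
by rewrite lecE /= => /andP[/eqP-> _].
Qed.

Lemma rnorm_ge0 (E : normedModType R[i]) (x : E) : 0 <= rnorm x.
Proof. by rewrite -lecR -rnormE normr_ge0. Qed.

Lemma ler_rnormD (E : normedModType R[i]) (x y : E) :
  rnorm (x + y) <= rnorm x + rnorm y.
Proof. by rewrite -lecR rmorphD /= -!rnormE ler_normD. Qed.

Lemma rnormZ (E : normedModType R[i]) (a : R[i]^o) (x : E) :
  rnorm (a *: x) = rnorm a * rnorm x.
Proof. by apply: complexI; rewrite rmorphM /= -!rnormE normrZ. Qed.

Lemma rnorm_eq0 (E : normedModType R[i]) (x : E) : rnorm x = 0 -> x = 0.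
Proof. by move=> x0; apply/eqP; rewrite -normr_eq0 rnormE x0. Qed.

End RealNorm.

Section BoundedOperators.
Variables (R : realType) (E F : normedModType R[i]).

Definition blinop_pred : {pred E -> F} :=
  [pred f | `[< linear f /\ continuous f >]].

Record blinop := Blinop {
  blinop_fun :> E -> F;
  _ : blinop_fun \in blinop_pred }.

HB.instance Definition _ := [isSub for blinop_fun].
HB.instance Definition _ := [Choice of blinop by <:].

Lemma blinop_submod_closed : submod_closed blinop_pred.
Proof.
split=> [|a f g]; rewrite !inE.
  split=> [b x y|x]; first by rewrite scaler0 addr0.
  exact: cvg_cst.
move=> [fl fc] [gl gc]; split=> [b x y|x].
  rewrite !fctE fl gl !scalerDr !scalerA [a * b]mulrC.
  by rewrite -!addrA; congr (_ + _); rewrite addrCA.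
apply: cvgD; [apply: cvgZl_tmp; exact: fc|exact: gc].
Qed.

HB.instance Definition _ :=
  GRing.isSubmodClosed.Build R[i] (E -> F) blinop_pred blinop_submod_closed.
HB.instance Definition _ := [SubChoice_isSubLmodule of blinop by <:].

Lemma blinop_linear (f : blinop) : linear f.
Proof. by case: f => f /=; rewrite inE => -[]. Qed.

Lemma blinop_continuous (f : blinop) : continuous f.
Proof. by case: f => f /=; rewrite inE => -[]. Qed.

HB.instance Definition _ (f : blinop) :=
  GRing.isLinear.Build R[i] E F *:%R f (@blinop_linear f).

Definition opnorm (f : blinop) : R :=
  sup [set rnorm (f x) | x in [set x : E | rnorm x <= 1]].

Lemma opnorm_has_ubound (f : blinop) :
  has_ubound [set rnorm (f x) | x in [set x : E | rnorm x <= 1]].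
Proof.
have /bounded_funP/(_ 1)[M fM] : bounded_near f (nbhs (0 : E)).
  by apply: continuous_linear_bounded; exact: blinop_continuous.
exists (complex.Re M) => _ [x x1 <-].
have : `|f x| <= M by apply: fM; rewrite rnormE lecR.
by rewrite rnormE lecE /= => /andP[].
Qed.

Lemma opnorm_ub (f : blinop) (x : E) : rnorm x <= 1 -> rnorm (f x) <= opnorm f.
Proof. by move=> x1; apply: ub_le_sup; [exact: opnorm_has_ubound|exists x]. Qed.

Lemma opnorm_nonempty (f : blinop) :
  [set rnorm (f x) | x in [set x : E | rnorm x <= 1]] !=set0.
Proof. by exists (rnorm (f 0)), 0 => //=; rewrite /rnorm normr0. Qed.

Lemma ler_opnormD (f g : blinop) : opnorm (f + g) <= opnorm f + opnorm g.
Proof.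
apply: ge_sup; first exact: opnorm_nonempty.
move=> _ [x x1 <-]; apply: (le_trans (ler_rnormD _ _)).
by apply: lerD; apply: opnorm_ub.
Qed.

Lemma rnorm_le_opnormZ (a : R[i]^o) (f : blinop) :
  opnorm (a *: f) <= rnorm a * opnorm f.
Proof.
apply: ge_sup; first exact: opnorm_nonempty.
move=> _ [x x1 <-]; rewrite [_ x]/(a *: f x) rnormZ.
by rewrite ler_wpM2l ?rnorm_ge0 ?opnorm_ub.
Qed.

Lemma opnormZ (a : R[i]^o) (f : blinop) :
  opnorm (a *: f) = rnorm a * opnorm f.
Proof.
apply/eqP; rewrite eq_le rnorm_le_opnormZ /=.
have [->|a0] := eqVneq a 0.
  rewrite {1}/rnorm normr0 mul0r scale0r.
  apply: le_trans (opnorm_ub 0 (x := 0) _); first exact: rnorm_ge0.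
  by rewrite /rnorm normr0.
have na0 : 0 < rnorm a.
  rewrite lt_neqAle rnorm_ge0 andbT eq_sym; apply: contra a0 => /eqP.
  by move/rnorm_eq0/eqP.
rewrite -ler_pdivlMl //; have := rnorm_le_opnormZ a^-1 (a *: f).
rewrite scalerA mulVf // scale1r => /le_trans; apply.
suff -> : rnorm (a^-1 : R[i]^o) = (rnorm a)^-1 by [].
apply: (mulfI (lt0r_neq0 na0)); rewrite mulfV ?lt0r_neq0 // -rnormZ.
by rewrite /GRing.scale /= mulfV // /rnorm normr1.
Qed.

Lemma opnorm_eq0 (f : blinop) : opnorm f = 0 -> f = 0.
Proof.
move=> f0; apply: val_inj; apply/funext => x; rewrite [RHS]/(0 : F).
have [->|x0] := eqVneq x 0; first exact: linear0.
have nx0 : 0 < `|x| by rewrite normr_gt0.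
have : rnorm (f (`|x|^-1 *: x)) <= 0.
  rewrite -f0; apply: opnorm_ub; rewrite /rnorm normrZ normfV normr_id mulVf //.
  by rewrite normr_eq0.
move=> fx; have /rnorm_eq0 : rnorm (f (`|x|^-1 *: x)) = 0.
  by apply/eqP; rewrite eq_le fx rnorm_ge0.
rewrite linearZ /= => /eqP; rewrite scaler_eq0 invr_eq0 normr_eq0 (negPf x0).
by move/eqP.
Qed.

Let opnormC (f : blinop) : R[i] := (opnorm f)%:C.

Let opnormC_D f g : opnormC (f + g) <= opnormC f + opnormC g.
Proof. by rewrite /opnormC -rmorphD lecR ler_opnormD. Qed.

Let opnormC_Z (a : R[i]) f : opnormC (a *: f) = `|a| * opnormC f.
Proof. by rewrite /opnormC (opnormZ a) rmorphM /= -(@rnormE _ R[i]^o). Qed.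

Let opnormC_eq0 f : opnormC f = 0 -> f = 0.
Proof. by move/complexI/opnorm_eq0. Qed.

HB.instance Definition _ :=
  Lmodule_isNormed.Build R[i] blinop opnormC_D opnormC_Z opnormC_eq0.

Lemma rnorm_blinop (f : blinop) : rnorm f = opnorm f.
Proof. by []. Qed.

End BoundedOperators.

Definition dual (R : realType) (E : normedModType R[i]) : normedModType R[i] :=
  blinop E R[i]^o.

Section Subspaces.
Variables (R : realType) (E : normedModType R[i]) (N : submodClosed E).

Record lsubspace := Lsubspace { lsubspace_val : E; _ : lsubspace_val \in N }.

HB.instance Definition _ := [isSub for lsubspace_val].
HB.instance Definition _ := [Choice of lsubspace by <:].
HB.instance Definition _ := [SubChoice_isSubLmodule of lsubspace by <:].

Let normN (x : lsubspace) : R[i] := `|lsubspace_val x|.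

Let normN_D x y : normN (x + y) <= normN x + normN y.
Proof. exact: ler_normD. Qed.

Let normN_Z (a : R[i]) x : normN (a *: x) = `|a| * normN x.
Proof. exact: normrZ. Qed.

Let normN_eq0 x : normN x = 0 -> x = 0.
Proof. by move=> /normr0_eq0 x0; apply: val_inj. Qed.

HB.instance Definition _ :=
  Lmodule_isNormed.Build R[i] lsubspace normN_D normN_Z normN_eq0.

Definition finite_dim : Prop :=
  exists n (v : 'I_n -> E), [set` N] `<=` lspan (range v).

Lemma lsubspace_val_blinop : lsubspace_val \in @blinop_pred R lsubspace E.
Proof.
have lN : linear lsubspace_val by [].
pose f : {linear lsubspace -> E} :=
  HB.pack lsubspace_val (GRing.isLinear.Build R[i] lsubspace E *:%R _ lN).
rewrite inE; split=> //; apply: (@bounded_linear_continuous _ _ _ f).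
by apply/bounded_funP => r; exists r.
Qed.

Definition inclusion : blinop lsubspace E := Blinop lsubspace_val_blinop.

End Subspaces.

Section MultilinearForms.
Variables (R : realType) (k : nat).

Definition upd (E : Type) (x : 'I_k -> E) (i : 'I_k) (u : E) : 'I_k -> E :=
  fun j => if j == i then u else x j.

Definition multilinear (E : lmodType R[i]) (f : ('I_k -> E) -> R[i]^o) : Prop :=
  forall i (x : 'I_k -> E) (a : R[i]) (u v : E),
    f (upd x i (a *: u + v)) = a *: f (upd x i u) + f (upd x i v).

Record mlform (E : lmodType R[i]) := MLForm {
  mlform_fun :> ('I_k -> E) -> R[i]^o;
  mlformP : multilinear mlform_fun }.

Lemma mlform_eq (E : lmodType R[i]) (f g : mlform E) : f =1 g -> f = g.
Proof.
case: f g => [f fP] [g gP] /= /funext fg; case: _ / fg gP => gP.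
by congr MLForm; exact: Prop_irrelevance.
Qed.

End MultilinearForms.

Section Tensors.
Variables (R : realType) (k : nat) (E : lmodType R[i]).

(* The algebraic tensor power of [E], as the space of linear functionals on
   the [k]-linear forms on [E] spanned by the evaluations
   [x_1 (x) ... (x) x_k : f |-> f (x_1, ..., x_k)]. This is a tensor power
   because a linear combination of elementary tensors is zero if and only if
   every [k]-linear form takes it to zero. *)
Definition tensor_pred : {pred mlform k E -> R[i]^o} :=
  [pred u | `[< lspan (range (fun (x : 'I_k -> E) (f : mlform k E) => f x)) u >]].

Record tensor := Tensor {
  tensor_fun :> mlform k E -> R[i]^o;
  _ : tensor_fun \in tensor_pred }.

HB.instance Definition _ := [isSub for tensor_fun].
HB.instance Definition _ := [Choice of tensor by <:].

Lemma tensor_submod_closed : submod_closed tensor_pred.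
Proof.
split=> [|a u v]; rewrite !inE; first exact: lspan0.
exact: lspanP.
Qed.

HB.instance Definition _ :=
  GRing.isSubmodClosed.Build R[i] (mlform k E -> R[i]^o) tensor_pred
    tensor_submod_closed.
HB.instance Definition _ := [SubChoice_isSubLmodule of tensor by <:].

Lemma etensor_subproof (x : 'I_k -> E) :
  (fun f : mlform k E => f x) \in tensor_pred.
Proof. by rewrite inE; apply: lspan_gen; exists x. Qed.

Definition etensor (x : 'I_k -> E) : tensor := Tensor (etensor_subproof x).

Lemma tensor_ind (W : tensor -> Prop) : W 0 ->
  (forall a x v, W v -> W (a *: etensor x + v)) -> forall u, W u.
Proof.
move=> W0 Wl u.
pose S := [set f | exists2 v, W v & tensor_fun v = f].
have : S (tensor_fun u).
  case: u => u /= uP; move: (uP); rewrite inE; move: u {uP}; apply: lspan_ind.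
    by exists 0.
  move=> a _ _ [x _ <-] [v Wv <-]; exists (a *: etensor x + v) => //.
  exact: Wl.
by move=> [v Wv vu]; rewrite -(val_inj vu).
Qed.

Lemma tensor_multilinear i (x : 'I_k -> E) (a : R[i]) (u v : E) :
  etensor (upd x i (a *: u + v)) =
  a *: etensor (upd x i u) + etensor (upd x i v).
Proof. by apply: val_inj; apply/funext => f; exact: mlformP. Qed.

Definition symmetric_tensors : set tensor :=
  lspan (range (fun x : E => etensor (fun=> x))).

End Tensors.

Section TensorOperations.
Variable R : realType.

Section Map.
Variables (k : nat) (E F : lmodType R[i]) (T : {linear E -> F}).

Lemma mlform_comp_subproof (f : mlform k F) :
  multilinear (fun x : 'I_k -> E => f (T \o x)).
Proof.
move=> i x a u v; have updT w : T \o upd x i w = upd (T \o x) i (T w).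
  by apply/funext => j; rewrite /upd /=; case: eqP.
by rewrite !updT linearP mlformP.
Qed.

Definition mlform_comp (f : mlform k F) : mlform k E :=
  MLForm (mlform_comp_subproof f).

Lemma tensor_map_subproof (u : tensor k E) :
  (fun f : mlform k F => u (mlform_comp f)) \in @tensor_pred R k F.
Proof.
move: u; apply: tensor_ind => [|a x v]; rewrite !inE; first exact: lspan0.
by apply: lspanP; apply: lspan_gen; exists (T \o x).
Qed.

Definition tensor_map (u : tensor k E) : tensor k F :=
  Tensor (tensor_map_subproof u).

Lemma tensor_mapE (x : 'I_k -> E) :
  tensor_map (etensor x) = etensor (T \o x).
Proof. exact: val_inj. Qed.

Lemma tensor_map_is_linear : linear tensor_map.
Proof. by move=> a u v; apply: val_inj. Qed.

End Map.

Section Product.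
Variables (k l : nat) (E : lmodType R[i]).

Definition fcat (x : 'I_k -> E) (y : 'I_l -> E) : 'I_(k + l) -> E :=
  fun i => match fintype.split i with inl j => x j | inr j => y j end.

Lemma fcat_updr x y i u : fcat x (upd y i u) = upd (fcat x y) (rshift k i) u.
Proof.
apply/funext => j; rewrite /fcat /upd; case: (splitP j) => j' jj'.
  rewrite (_ : j = lshift l j') ?eq_lrshift //; exact: val_inj.
by rewrite (_ : j = rshift k j') ?eq_rshift //; exact: val_inj.
Qed.

Lemma fcat_updl x y i u : fcat (upd x i u) y = upd (fcat x y) (lshift l i) u.
Proof.
apply/funext => j; rewrite /fcat /upd; case: (splitP j) => j' jj'.
  by rewrite (_ : j = lshift l j') ?eq_lshift //; exact: val_inj.
by rewrite (_ : j = rshift k j') ?eq_rlshift //; exact: val_inj.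
Qed.

Lemma mlform_app_subproof (f : mlform (k + l) E) (x : 'I_k -> E) :
  multilinear (fun y : 'I_l -> E => f (fcat x y)).
Proof. by move=> i y a u v; rewrite !fcat_updr mlformP. Qed.

Definition mlform_app f x : mlform l E := MLForm (mlform_app_subproof f x).

Lemma mlform_contract_subproof (t : tensor l E) (f : mlform (k + l) E) :
  multilinear (fun x : 'I_k -> E => t (mlform_app f x)).
Proof.
move=> i x a u v; move: t; apply: tensor_ind => [|b y t IH].
  by rewrite ![tensor_fun 0 _]/(0 : R[i]^o) scaler0 addr0.
have tE g : (b *: etensor y + t) g = b *: g y + t g by [].
rewrite !tE IH /= !fcat_updl mlformP !scalerDr addrACA !scalerA.
by rewrite [b * a]mulrC.
Qed.

Definition mlform_contract t f : mlform k E :=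
  MLForm (mlform_contract_subproof t f).

Lemma tensor_mul_subproof (s : tensor k E) (t : tensor l E) :
  (fun f => s (mlform_contract t f)) \in @tensor_pred R (k + l) E.
Proof.
rewrite inE; move: s; apply: tensor_ind => [|a x s IH]; first exact: lspan0.
apply: lspanP IH; move: t; apply: tensor_ind => [|b y t IH]; first exact: lspan0.
by apply: lspanP IH; apply: lspan_gen; exists (fcat x y).
Qed.

Definition tensor_mul (s : tensor k E) (t : tensor l E) : tensor (k + l) E :=
  Tensor (tensor_mul_subproof s t).

Lemma tensor_mulE x y :
  tensor_mul (etensor x) (etensor y) = etensor (fcat x y).
Proof. exact: val_inj. Qed.

Lemma tensor_mul_linearl t : linear (tensor_mul^~ t).
Proof. by move=> a u v; apply: val_inj. Qed.

Lemma tensor_mul_linearr s : linear (tensor_mul s).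
Proof.
move=> a u v; move: s; apply: tensor_ind => [|b x s IH].
  have mul0 w : tensor_mul 0 w = 0 by exact: val_inj.
  by rewrite !mul0 scaler0 addr0.
have basis : tensor_mul (etensor x) (a *: u + v) =
    a *: tensor_mul (etensor x) u + tensor_mul (etensor x) v by exact: val_inj.
rewrite !tensor_mul_linearl IH basis !scalerDr addrACA !scalerA.
by rewrite [b * a]mulrC.
Qed.

End Product.

Section Symmetrization.
Variables (m : nat) (E : lmodType R[i]).

Lemma mlform_perm_subproof (eta : 'S_m) (f : mlform m E) :
  multilinear (fun x : 'I_m -> E => f (x \o eta)).
Proof.
move=> i x a u v.
have upd_eta w : upd x i w \o eta = upd (x \o eta) ((eta^-1)%g i) w.
  by apply/funext => j; rewrite /upd /= -{1}(permKV eta i) (inj_eq perm_inj).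
by rewrite !upd_eta mlformP.
Qed.

Definition mlform_perm eta f : mlform m E := MLForm (mlform_perm_subproof eta f).

Lemma tensor_perm_subproof (eta : 'S_m) (u : tensor m E) :
  (fun f => u (mlform_perm eta f)) \in @tensor_pred R m E.
Proof.
move: u; apply: tensor_ind => [|a x v]; rewrite !inE; first exact: lspan0.
by apply: lspanP; apply: lspan_gen; exists (x \o eta).
Qed.

Definition tensor_perm (eta : 'S_m) (u : tensor m E) : tensor m E :=
  Tensor (tensor_perm_subproof eta u).

Lemma tensor_permE eta (x : 'I_m -> E) :
  tensor_perm eta (etensor x) = etensor (x \o eta).
Proof. exact: val_inj. Qed.

Lemma tensor_perm_is_linear eta : linear (tensor_perm eta).
Proof. by move=> a u v; apply: val_inj. Qed.

Definition symmetrization (u : tensor m E) : tensor m E :=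
  (m`!%:R : R[i])^-1 *: \sum_(eta : 'S_m) tensor_perm eta u.

End Symmetrization.

End TensorOperations.

Section PolynomialsAndTensors.
Variables (R : realType) (k : nat) (E : normedModType R[i]).

Definition homogeneous_polynomial (P : E -> R[i]^o) : Prop :=
  (exists A : mlform k E, forall x, P x = A (fun=> x)) /\ continuous P.

Lemma prod_form_subproof (x : E) :
  multilinear (fun g : 'I_k -> dual E => \prod_(i < k) g i x).
Proof.
move=> i g a u v; have prodE w :
    \prod_(j < k) upd g i w j x = w x * \prod_(j < k | j != i) g j x.
  rewrite (bigD1 i) //= {1}/upd eqxx; congr (_ * _).
  by apply: eq_bigr => j /negPf ji; rewrite /upd ji.
rewrite !prodE [X in X * _]/(a * u x + v x).
by rewrite mulrDl /GRing.scale /= mulrA.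
Qed.

Definition prod_form (x : E) : mlform k (dual E) :=
  MLForm (prod_form_subproof x).

(* The linear map from the tensor power of [E'] to functions on [E] that takes
   [g (x) ... (x) g] to [g ^ k] (see [poly_of_tensorE]). *)
Definition poly_of_tensor (u : tensor k (dual E)) : E -> R[i]^o :=
  fun x => u (prod_form x).

Lemma poly_of_tensorE (g : dual E) :
  poly_of_tensor (etensor (fun=> g)) = fun x => g x ^+ k.
Proof.
by apply/funext => x; rewrite /poly_of_tensor /= prodr_const card_ord.
Qed.

Lemma poly_of_tensor_is_linear : linear poly_of_tensor.
Proof. by []. Qed.

(* The inverse of [poly_of_tensor]. It is meant for finite dimensional [E]
   only, where [poly_of_tensor] is a bijection from the symmetric tensors on
   [E'] to the [k]-homogeneous polynomials on [E]. *)
Definition tensor_of_poly (P : E -> R[i]^o) : tensor k (dual E) :=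
  xget 0 [set u | symmetric_tensors u /\ poly_of_tensor u = P].

End PolynomialsAndTensors.

Section TensorNorms.
Variables (R : realType) (k : nat).

(* A norm on the symmetric tensors is represented by a real function on all
   tensors, whose values outside of [symmetric_tensors] are irrelevant. *)
Definition tensor_norm_fun := forall E : normedModType R[i], tensor k E -> R.

Variable alpha : tensor_norm_fun.

Record is_symmetric_tensor_norm : Prop := {
  tensor_normD : forall (E : normedModType R[i]) (s t : tensor k E),
    symmetric_tensors s -> symmetric_tensors t ->
    alpha (s + t) <= alpha s + alpha t;
  tensor_normZ : forall (E : normedModType R[i]) (a : R[i]^o) (s : tensor k E),
    symmetric_tensors s -> alpha (a *: s) = rnorm a * alpha s;
  tensor_norm_eq0 : forall (E : normedModType R[i]) (s : tensor k E),
    symmetric_tensors s -> alpha s = 0 -> s = 0;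
  tensor_norm1 : alpha (etensor (fun=> 1 : R[i]^o)) = 1;
  tensor_norm_map : forall (E F : normedModType R[i]) (T : blinop E F)
    (s : tensor k E), symmetric_tensors s ->
    alpha (tensor_map T s) <= rnorm T ^+ k * alpha s }.

Definition finitely_generated : Prop :=
  forall (E : normedModType R[i]) (s : tensor k E), symmetric_tensors s ->
  alpha s = inf [set r | exists (N : submodClosed E) (s' : tensor k (lsubspace N)),
    [/\ finite_dim N, symmetric_tensors s', tensor_map (inclusion N) s' = s
      & r = alpha s']].

Definition max_norm (E : normedModType R[i]) (P : E -> R[i]^o) : \bar R :=
  ereal_sup [set r | exists2 N : submodClosed E, finite_dim N &
                       r = (alpha (tensor_of_poly k (P \o inclusion N)))%:E].

Definition max_ideal (E : normedModType R[i]) : set (E -> R[i]^o) :=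
  [set P | homogeneous_polynomial k P /\ (max_norm P < +oo)%E].

Definition finite_rank (E F : normedModType R[i]) : set (blinop E F) :=
  [set S | exists n (v : 'I_n -> F), range S `<=` lspan (range v)].

Definition approximable (E F : normedModType R[i]) : set (blinop E F) :=
  closure (@finite_rank E F).

Definition min_factorization (E : normedModType R[i]) (P : E -> R[i]^o)
    (E1 : completeNormedModType R[i]) (T : blinop E E1) (Q : E1 -> R[i]^o) :=
  [/\ approximable T, max_ideal Q & P = Q \o T].

Definition min_ideal (E : normedModType R[i]) : set (E -> R[i]^o) :=
  [set P | exists (E1 : completeNormedModType R[i]) (T : blinop E E1)
             (Q : E1 -> R[i]^o), min_factorization P T Q].

Definition min_norm (E : normedModType R[i]) (P : E -> R[i]^o) : \bar R :=
  ereal_inf [set r | exists (E1 : completeNormedModType R[i]) (T : blinop E E1)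
                       (Q : E1 -> R[i]^o),
    min_factorization P T Q /\ r = (max_norm Q * (rnorm T ^+ k)%:E)%E].

End TensorNorms.

(* Main.v *)
Require Import Defs.
From HB Require Import structures.
From mathcomp Require Import all_boot all_order all_algebra perm complex.
From mathcomp Require Import ring lra.
From mathcomp Require Import all_classical all_reals all_analysis.

Set Implicit Arguments.
Unset Strict Implicit.
Unset Printing Implicit Defensive.

Import Order.TTheory GRing.Theory Num.Theory numFieldNormedType.Exports.
Local Open Scope classical_set_scope.
Local Open Scope ring_scope.
Local Open Scope complex_scope.

(** The proof compares the three statements on finite dimensional spaces, where
they say the same thing, and then moves between finite dimensional and general
spaces.

On a finite dimensional space [E] a [k]-homogeneous polynomial is the same as
a symmetric tensor over the dual, the maximal norm of the polynomial is the
tensor norm of the tensor ([max_norm_poly_of_tensor],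
[tensor_norm_le_max_norm]), and the minimal norm equals the maximal norm
because the identity of [E] is an approximable operator
([min_ideal_finite_dim], [max_norm_le_min_norm]). Under this dictionary the
product of polynomials is the symmetrized product of tensors
([poly_of_symmetric_product]). That the dictionary is well defined rests on
two facts: the polarization identity ([polarization]), which shows that
symmetrized tensors are combinations of powers and that such a combination is
determined by its polynomial; and the existence of continuous coordinates on a
finite dimensional normed space ([finite_dim_coordinates]), which also makes
that space a Banach space.

(i) implies (ii). If [P = P1 o T1] and [Q = Q1 o T2] with [T1], [T2]
approximable into [E1] and [E2], then [x |-> (T1 x / a, T2 x / b)] is an
approximable operator into the Banach space [E1 * E2] with the maximum norm.
It has norm at most 1 when [a] and [b] dominate the norms of [T1] and [T2], and
[P Q] factors through it by the product of the polynomials [P1 (a z1)] and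
[Q1 (b z2)], to which (i) applies ([min_factorization_product]). Optimizing over
[a], [b] and the factorizations gives (ii).

(ii) implies (iii). Finite generation replaces the two tensors by tensors over
one finite dimensional subspace [M] of [E'], at the cost of an arbitrarily
small increase of the norms. The inclusion of [M] into [E'] factors through
the bidual of [M] by contractions: the canonical embedding of [M], followed
by the transpose of the map [E -> M'] that sends a point to the evaluation at
this point of the functionals in [M]. Hence it is enough to have the inequality
for tensors over the dual of the finite dimensional space [M'], where it is (ii)
by the dictionary ([minimal_product_finite_dim], [tensor_product_bound_bidual]).

(iii) implies (i). The maximal norm is a supremum over finite dimensional
subspaces [N], and on each of them (iii) for the Banach space [N] is the
required inequality ([tensor_product_bound_maximal]). *)

(** * Bounded operators *)

Section RealNormTheory.
Variables (R : realType) (E : normedModType R[i]).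
Implicit Types (x y : E).

Lemma rnorm0 : rnorm (0 : E) = 0.
Proof. by rewrite /rnorm normr0. Qed.

Lemma rnormN x : rnorm (- x) = rnorm x.
Proof. by rewrite /rnorm normrN. Qed.

Lemma rnorm_distC x y : rnorm (x - y) = rnorm (y - x).
Proof. by rewrite /rnorm distrC. Qed.

Lemma ltr_rnormC x (r : R) : (`|x| < r%:C) = (rnorm x < r).
Proof. by rewrite rnormE ltcR. Qed.

Lemma rnorm_gt0 x : x != 0 -> 0 < rnorm x.
Proof.
move=> x0; rewrite lt_neqAle rnorm_ge0 andbT eq_sym.
by apply: contra x0 => /eqP /rnorm_eq0 ->.
Qed.

(** The library measures distances in a complex normed space by positive elements
of [R[i]]; these are real, so that all estimates can be done in [R]. *)
Lemma gt0_complexE (e : R[i]) : 0 < e -> e = (complex.Re e)%:C /\ 0 < complex.Re e.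
Proof.
case: e => a b; rewrite ltcE /= => /andP[/eqP -> a0].
by split.
Qed.

Lemma rnorm_cvgP (F : set_system E) {FF : Filter F} x :
  (forall e : R, 0 < e -> F [set y | rnorm (x - y) < e]) <-> F --> x.
Proof.
split=> [H|/cvgrPdist_lt H e e0].
  apply/cvgrPdist_lt => e /gt0_complexE[-> e0].
  by near=> y; rewrite ltr_rnormC; near: y; apply: H.
have e0C : 0 < e%:C :> R[i] by rewrite ltcR.
by apply: filterS (H _ e0C) => y /=; rewrite ltr_rnormC.
Unshelve. all: by end_near. Qed.

Lemma rnorm_cauchyP (F : set_system E) {FF : ProperFilter F} :
  cauchy F -> forall e : R, 0 < e -> exists x, F [set y | rnorm (x - y) < e].
Proof.
move=> /cauchyP H e e0.
have e0C : 0 < e%:C :> R[i] by rewrite ltcR.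
have [x Fx] := H _ e0C; exists x; apply: filterS Fx => y.
by rewrite -ball_normE /= ltr_rnormC.
Qed.

End RealNormTheory.

Section BoundedOperatorTheory.
Variables (R : realType).

Lemma rnorm_blinop_le (E F : normedModType R[i]) (T : blinop E F) x :
  rnorm (T x) <= rnorm T * rnorm x.
Proof.
have [->|x0] := eqVneq x 0; first by rewrite linear0 !rnorm0 mulr0.
have nx := rnorm_gt0 x0.
have nxC : (rnorm x)%:C != 0 :> R[i].
  by rewrite (inj_eq (@complexI R)) gt_eqF.
have nV : rnorm (((rnorm x)%:C)^-1 : R[i]^o) = (rnorm x)^-1.
  by rewrite /rnorm normfV -rnormE normr_id rnormE -fmorphV.
have := opnorm_ub T (x := ((rnorm x)%:C)^-1 *: x).
rewrite rnormZ nV mulVf ?gt_eqF // => /(_ (lexx _)).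
by rewrite linearZ rnormZ nV ler_pdivrMl // mulrC.
Qed.

Section Construction.
Variables (E F : normedModType R[i]) (f : E -> F) (M : R).
Hypothesis (fl : linear f) (fM : forall x, rnorm (f x) <= M * rnorm x).

Lemma bounded_blinop_pred : f \in @blinop_pred R E F.
Proof.
pose g : {linear E -> F} := HB.pack f (GRing.isLinear.Build R[i] E F *:%R f fl).
rewrite inE; split=> //; apply: (@bounded_linear_continuous _ _ _ g).
apply/bounded_funP => r; exists (`|M|%:C * r) => x xr.
apply: le_trans (ler_wpM2l _ xr); last by rewrite lecR.
rewrite !rnormE -rmorphM lecR (le_trans (fM x)) //.
by rewrite ler_wpM2r ?rnorm_ge0 ?ler_norm.
Qed.

Definition bounded_blinop : blinop E F := Blinop bounded_blinop_pred.

Lemma rnorm_bounded_blinop : 0 <= M -> rnorm bounded_blinop <= M.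
Proof.
move=> M0; rewrite rnorm_blinop; apply: ge_sup; first exact: opnorm_nonempty.
move=> _ [x /= x1 <-]; apply: le_trans (fM x) _.
by rewrite -[leRHS]mulr1 ler_wpM2l.
Qed.

End Construction.

Lemma blinop_eq (E F : normedModType R[i]) (S T : blinop E F) : S =1 T -> S = T.
Proof. by move=> ST; apply: val_inj; apply/funext. Qed.

Lemma rnorm_blinop_leP (E F : normedModType R[i]) (T : blinop E F) (M : R) :
  0 <= M -> (forall x, rnorm (T x) <= M * rnorm x) -> rnorm T <= M.
Proof.
move=> M0 TM; rewrite -[T](_ : bounded_blinop (blinop_linear T) TM = T).
  exact: rnorm_bounded_blinop.
exact: blinop_eq.
Qed.

Lemma comp_blinop_linear (E F G : normedModType R[i]) (S : blinop F G)
  (T : blinop E F) : linear (S \o T).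
Proof. by move=> a x y /=; rewrite !linearP. Qed.

Lemma comp_blinop_bound (E F G : normedModType R[i]) (S : blinop F G)
  (T : blinop E F) x : rnorm ((S \o T) x) <= rnorm S * rnorm T * rnorm x.
Proof.
apply: le_trans (rnorm_blinop_le _ _) _; rewrite -mulrA.
by rewrite ler_wpM2l ?rnorm_ge0 ?rnorm_blinop_le.
Qed.

Definition comp_blinop (E F G : normedModType R[i]) (S : blinop F G)
    (T : blinop E F) : blinop E G :=
  bounded_blinop (comp_blinop_linear S T) (comp_blinop_bound S T).

Lemma rnorm_comp_blinop (E F G : normedModType R[i]) (S : blinop F G)
  (T : blinop E F) : rnorm (comp_blinop S T) <= rnorm S * rnorm T.
Proof. by apply: rnorm_bounded_blinop; rewrite mulr_ge0 ?rnorm_ge0. Qed.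

Section Adjoint.
Variables (E F : normedModType R[i]) (T : blinop E F).

Lemma adjoint_linear : linear ((@comp_blinop E F R[i]^o)^~ T).
Proof. by move=> a g h; apply: blinop_eq. Qed.

Lemma adjoint_bound (g : dual F) : 
  rnorm (comp_blinop g T : dual E) <= rnorm T * rnorm g.
Proof. by rewrite mulrC; exact: rnorm_comp_blinop. Qed.

Definition adjoint : blinop (dual F) (dual E) :=
  bounded_blinop adjoint_linear adjoint_bound.

Lemma rnorm_adjoint : rnorm adjoint <= rnorm T.
Proof. by apply: rnorm_bounded_blinop; exact: rnorm_ge0. Qed.

End Adjoint.

Section Bidual.
Variable E : normedModType R[i].

Section Evaluation.
Variable x : E.

Lemma evaluation_linear : linear (fun g : dual E => g x : R[i]^o).
Proof. by []. Qed.

Lemma evaluation_bound (g : dual E) : rnorm (g x : R[i]^o) <= rnorm x * rnorm g.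
Proof. by rewrite mulrC; exact: rnorm_blinop_le. Qed.

Definition evaluation : dual (dual E) :=
  bounded_blinop evaluation_linear evaluation_bound.

End Evaluation.

Lemma bidual_linear : linear evaluation.
Proof. by move=> a x y; apply: blinop_eq => g; exact: (linearP g). Qed.

Lemma bidual_bound x : rnorm (evaluation x) <= 1 * rnorm x.
Proof. by rewrite mul1r; apply: rnorm_bounded_blinop; exact: rnorm_ge0. Qed.

Definition bidual_embedding : blinop E (dual (dual E)) :=
  bounded_blinop bidual_linear bidual_bound.

Lemma rnorm_bidual_embedding : rnorm bidual_embedding <= 1.
Proof. exact: rnorm_bounded_blinop. Qed.

End Bidual.

Lemma rnorm_inclusion (E : normedModType R[i]) (N : submodClosed E) :
  rnorm (inclusion N) <= 1.
Proof. by apply: rnorm_blinop_leP => // x; rewrite mul1r. Qed.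

Section Corestriction.
Variables (E F : normedModType R[i]) (N : submodClosed F) (T : blinop E F).
Hypothesis TN : forall x, T x \in N.

Lemma corestrict_linear : linear (fun x => Lsubspace (TN x)).
Proof. by move=> a x y; apply: val_inj; rewrite /= linearP. Qed.

Lemma corestrict_bound x : rnorm (Lsubspace (TN x)) <= rnorm T * rnorm x.
Proof. exact: rnorm_blinop_le. Qed.

Definition corestrict : blinop E (lsubspace N) :=
  bounded_blinop corestrict_linear corestrict_bound.

Lemma rnorm_corestrict : rnorm corestrict <= rnorm T.
Proof. by apply: rnorm_bounded_blinop; exact: rnorm_ge0. Qed.

Lemma inclusion_corestrict x : inclusion N (corestrict x) = T x.
Proof. by []. Qed.

End Corestriction.

End BoundedOperatorTheory.

(** * Multilinear forms and polarization *)

Section MultilinearExpansion.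
Variables (R : realType) (E : lmodType R[i]).

Lemma mlform_upd0 k (f : mlform k E) i (x : 'I_k -> E) : f (upd x i 0) = 0.
Proof.
have := mlformP f i x (-1) 0 0.
by rewrite !scaleN1r oppr0 addr0 addNr.
Qed.

Lemma mlform_upd_sum k (f : mlform k E) i (x : 'I_k -> E) (I : Type) (r : seq I)
  (v : I -> E) : f (upd x i (\sum_(a <- r) v a)) = \sum_(a <- r) f (upd x i (v a)).
Proof.
elim: r => [|a r IH]; first by rewrite !big_nil mlform_upd0.
by rewrite !big_cons -IH -[v a]scale1r mlformP !scale1r.
Qed.

Definition cons_fun (T : Type) k (a : T) (x : 'I_k -> T) : 'I_k.+1 -> T :=
  fun j => oapp x a (unlift ord0 j).

Lemma cons_fun_eta (T : Type) k (x : 'I_k.+1 -> T) :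
  x = cons_fun (x ord0) (x \o lift ord0).
Proof. by apply/funext => j; rewrite /cons_fun; case: unliftP => [i|] ->. Qed.

Lemma cons_fun_updr k a (x : 'I_k -> E) i u :
  cons_fun a (upd x i u) = upd (cons_fun a x) (lift ord0 i) u.
Proof.
apply/funext => j; rewrite /cons_fun /upd; case: unliftP => [j'|] -> /=.
  by rewrite (inj_eq lift_inj).
by [].
Qed.

Lemma cons_fun_updl k a b (x : 'I_k -> E) :
  cons_fun a x = upd (cons_fun b x) ord0 a.
Proof.
apply/funext => j; rewrite /cons_fun /upd; case: unliftP => [j'|] -> /=.
  by [].
by [].
Qed.

Lemma mlform_cons_subproof k (f : mlform k.+1 E) a :
  multilinear (fun x : 'I_k -> E => f (cons_fun a x)).
Proof. by move=> i x b u v; rewrite !cons_fun_updr mlformP. Qed.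

Definition mlform_cons k (f : mlform k.+1 E) a : mlform k E :=
  MLForm (mlform_cons_subproof f a).

Lemma mlform_scale k (f : mlform k E) (c : 'I_k -> R[i]) (x : 'I_k -> E) :
  f (fun j => c j *: x j) = (\prod_j c j) * f x.
Proof.
elim: k f c x => [|k IH] f c x.
  by rewrite big_ord0 mul1r; congr (f _); apply/funext => -[].
rewrite big_ord_recl [in LHS](cons_fun_eta (fun j => c j *: x j)).
rewrite (cons_fun_updl _ 0) -[c ord0 *: _]addr0 mlformP mlform_upd0 addr0.
rewrite -(cons_fun_updl _ 0) -[f _]/(mlform_cons f (x ord0) _).
rewrite (IH (mlform_cons f (x ord0)) (c \o lift ord0) (x \o lift ord0)) /=.
by rewrite -cons_fun_eta -mulrA.
Qed.

(** Expansion of the arguments one coordinate at a time: [cons_fun] and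
[mlform_cons] isolate the first one, and the choice functions on [k.+1] indices
are pairs of a choice for the first index and a choice for the others. *)
Lemma mlform_expand k (f : mlform k E) (I : finType) (w : 'I_k -> I -> E) :
  f (fun j => \sum_i w j i) =
  \sum_(g : {ffun 'I_k -> I}) f (fun j => w j (g j)).
Proof.
elim: k f w => [|k IH] f w.
  have g0 : {ffun 'I_0 -> I} by apply: finfun => -[].
  rewrite (bigD1 g0) //= big1 => [|g]; last first.
    by case/eqP; apply/ffunP => -[].
  by rewrite addr0; congr (f _); apply/funext => -[].
rewrite [in LHS](cons_fun_eta (fun j => \sum_i w j i)).
rewrite (cons_fun_updl _ 0) mlform_upd_sum.
pose h (p : I * {ffun 'I_k -> I}) : {ffun 'I_k.+1 -> I} :=
  finfun (cons_fun p.1 p.2).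
rewrite (reindex h) /=; last first.
  apply: onW_bij; exists (fun g : {ffun 'I_k.+1 -> I} => (g ord0, [ffun j => g (lift ord0 j)])).
    move=> [i g]; rewrite /h !ffunE /cons_fun unlift_none; congr pair.
    by apply/ffunP => j; rewrite !ffunE liftK.
  move=> g; apply/ffunP => j; rewrite /h ffunE /cons_fun.
  by case: unliftP => [j'|] -> //=; rewrite ffunE.
rewrite -(pair_bigA _ (fun i g => f (fun j => w j (h (i, g) j)))) /=.
apply: eq_bigr => i _; rewrite -(cons_fun_updl _ 0) -[f _]/(mlform_cons f (w ord0 i) _).
rewrite (IH (mlform_cons f (w ord0 i)) (fun j => w (lift ord0 j))).
apply: eq_bigr => g _ /=; congr (f _).
rewrite [RHS]cons_fun_eta; congr cons_fun; rewrite ?ffunE /cons_fun ?unlift_none //.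
by apply/funext => j; rewrite /= ffunE /cons_fun liftK.
Qed.

Lemma mlform_lincomb k (f : mlform k E) (I : finType) (c : 'I_k -> I -> R[i])
    (w : 'I_k -> I -> E) :
  f (fun j => \sum_i c j i *: w j i) =
  \sum_(g : {ffun 'I_k -> I}) (\prod_j c j (g j)) * f (fun j => w j (g j)).
Proof. by rewrite mlform_expand; apply: eq_bigr => g _; rewrite mlform_scale. Qed.

Lemma surjective_injectiveb k (g : {ffun 'I_k -> 'I_k}) :
  [forall i, i \in codom g] = injectiveb g.
Proof.
apply/idP/idP => [/forallP gs|/injectiveP gi].
  rewrite /injectiveb /dinjectiveb.
  apply: (leq_size_uniq (enum_uniq 'I_k)) => [i _|]; first exact: gs.
  by rewrite size_map.
apply/forallP => i; exact: inj_card_onto.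
Qed.

(** Expanding the left side gives the sum over all maps [g] of ['I_k] into itself
of [f (y \o g)] times the alternating number of sets [S] that contain the image
of [g]. By inclusion and exclusion this number is 1 if [g] is onto and 0
otherwise, and the maps onto a finite set of the same size are the
permutations. *)
Lemma polarization k (f : mlform k E) (y : 'I_k -> E) :
  \sum_(S : {set 'I_k}) (-1) ^+ #|~: S| * f (fun=> \sum_(i in S) y i) =
  \sum_(eta : 'S_k) f (y \o eta).
Proof.
pose a (g : {ffun 'I_k -> 'I_k}) : R[i] := ([forall i, i \in codom g])%:R.
transitivity (\sum_(g : {ffun 'I_k -> 'I_k}) a g * f (y \o g)).
  under eq_bigr => S _.
    have -> : \sum_(i in S) y i = \sum_i (i \in S)%:R *: y i.
      by rewrite big_mkcond; apply: eq_bigr => i _; case: ifP; rewrite ?scale1r ?scale0r.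
    rewrite (mlform_lincomb f (fun _ i => (i \in S)%:R) (fun=> y)) mulr_sumr.
    over.
  rewrite exchange_big; apply: eq_bigr => g _; under eq_bigr => S _ do rewrite mulrA.
  rewrite -mulr_suml; congr (_ * _).
  (* The product over [i] of 1 minus the indicator of not being in the image is
     inclusion and exclusion in closed form: expanding it gives the sum over [S]. *)
  have -> : a g = \prod_i (1 + - (i \notin codom g)%:R).
    rewrite /a; case: forallP => [gs|/forallP].
      by rewrite big1 // => i _; rewrite gs subr0.
    by rewrite negb_forall => /existsP[i gi]; rewrite (bigD1 i) //= gi subrr mul0r.
  rewrite bigA_distr; apply: eq_bigr => S _.
  rewrite [RHS](bigID (mem S)) /= [X in _ = X * _]big1 ?mul1r => [|i ->//].
  transitivity (\prod_(i in ~: S) - (i \notin codom g)%:R : R[i]); last first.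
    apply: eq_big => [i|i iS]; first by rewrite inE.
    by rewrite ifN //; move: iS; rewrite inE.
  rewrite prodrN; congr (_ * _).
  case: (boolP [forall j, g j \in S]) => [/forallP gS|].
    rewrite !big1 // => i; last by rewrite gS.
    rewrite inE => iS; case: (boolP (i \in codom g)) => // /codomP[j ij].
    by rewrite ij gS in iS.
  rewrite negb_forall => /existsP[j gj].
  rewrite (bigD1 j) //= (negPf gj) mul0r (bigD1 (g j)) ?inE //=.
  by rewrite codom_f mul0r.
under eq_bigr do rewrite /a surjective_injectiveb.
rewrite (bigID (fun g : {ffun 'I_k -> 'I_k} => injectiveb g)) /= addrC big1 ?add0r; last first.
  by move=> g /negPf ->; rewrite mul0r.
rewrite (reindex_onto (fun eta : 'S_k => val eta) (fun g : {ffun _} => insubd (1%g : 'S_k) g)); last first.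
  by move=> g gi; rewrite insubdK.
apply: eq_big => [eta|eta etai].
  by rewrite valKd eqxx andbT (valP eta).
rewrite (valP eta) mul1r; congr (f _); apply/funext => j /=.
by rewrite pvalE.
Qed.

End MultilinearExpansion.

(** * Functoriality and symmetrization of tensors *)

Section LinearSpanTheory.
Variables (K : pzRingType) (V : lmodType K).

Lemma lspanD (S : set V) u v : lspan S u -> lspan S v -> lspan S (u + v).
Proof. by move=> Su Sv; rewrite -[u]scale1r; exact: lspanP. Qed.

Lemma lspanZ (S : set V) a u : lspan S u -> lspan S (a *: u).
Proof. by move=> Su; rewrite -[_ *: _]addr0; apply: lspanP Su (lspan0 _). Qed.

Lemma lspan_sum (S : set V) (I : Type) (r : seq I) (P : pred I) (f : I -> V) :
  (forall i, P i -> lspan S (f i)) -> lspan S (\sum_(i <- r | P i) f i).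
Proof.
by move=> Sf; elim/big_ind: _ => //; [exact: lspan0|exact: lspanD].
Qed.

End LinearSpanTheory.

Section TensorTheory.
Variables (R : realType).

Lemma tensor_eq k (E : lmodType R[i]) (u v : tensor k E) :
  (forall f, u f = v f :> R[i]) -> u = v.
Proof. by move=> uv; apply: val_inj; apply/funext. Qed.

Lemma tensor_lincombE k (E : lmodType R[i]) (I : Type) (r : seq I)
    (c : I -> R[i]) (u : I -> tensor k E) (f : mlform k E) :
  (\sum_(i <- r) c i *: u i) f = \sum_(i <- r) c i * u i f.
Proof.
exact: (big_morph (fun v : tensor k E => v f : R[i]) (fun u v => erefl) erefl).
Qed.

Lemma symmetric_tensors_ind k (E : lmodType R[i]) (W : tensor k E -> Prop) : W 0 ->
  (forall a x v, W v -> W (a *: etensor (fun=> x) + v)) ->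
  forall u, symmetric_tensors u -> W u.
Proof.
move=> W0 Wl u; apply: (lspan_ind (W := W)) => // a _ v [x _ <-].
exact: Wl.
Qed.

Lemma symmetric_tensor_map k (E F : lmodType R[i]) (T : {linear E -> F})
  (u : tensor k E) : symmetric_tensors u -> symmetric_tensors (tensor_map T u).
Proof.
move: u; apply: symmetric_tensors_ind => [|a x v IH].
  rewrite (_ : tensor_map T 0 = 0); first exact: lspan0.
  exact: val_inj.
rewrite tensor_map_is_linear; apply: lspanP IH; apply: lspan_gen.
exists (T x) => //; exact: val_inj.
Qed.

Lemma tensor_map_comp k (E F G : lmodType R[i]) (S : {linear F -> G})
  (T : {linear E -> F}) (U : {linear E -> G}) (u : tensor k E) :
  (forall x, S (T x) = U x) -> tensor_map S (tensor_map T u) = tensor_map U u.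
Proof.
move=> STU; apply: tensor_eq => f; congr (u _).
by apply: mlform_eq => x /=; congr (f _); apply/funext => j; exact: STU.
Qed.

Lemma tensor_map_id k (E : lmodType R[i]) (T : {linear E -> E}) (u : tensor k E) :
  (forall x, T x = x) -> tensor_map T u = u.
Proof.
move=> T1; apply: tensor_eq => f; congr (u _).
by apply: mlform_eq => x /=; congr (f _); apply/funext => j; exact: T1.
Qed.

Lemma tensor_map_mul k l (E F : lmodType R[i]) (T : {linear E -> F})
    (s : tensor k E) (t : tensor l E) :
  tensor_map T (tensor_mul s t) = tensor_mul (tensor_map T s) (tensor_map T t).
Proof.
apply: tensor_eq => f; congr (s _).
apply: mlform_eq => x /=; congr (t _); apply: mlform_eq => y /=; congr (f _).
by apply/funext => j; rewrite /fcat /=; case: (fintype.split j).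
Qed.

Lemma symmetrizationE m (E : lmodType R[i]) (u : tensor m E) (f : mlform m E) :
  symmetrization u f = (m`!%:R)^-1 * \sum_(eta : 'S_m) u (mlform_perm eta f).
Proof.
rewrite [LHS]/(_ * tensor_fun (\sum_eta tensor_perm eta u) f); congr (_ * _).
under [in LHS]eq_bigr do rewrite -[tensor_perm _ _]scale1r.
by rewrite tensor_lincombE; under eq_bigr do rewrite mul1r.
Qed.

Lemma tensor_map_symmetrization m (E F : lmodType R[i]) (T : {linear E -> F})
    (u : tensor m E) :
  tensor_map T (symmetrization u) = symmetrization (tensor_map T u).
Proof.
apply: tensor_eq => f.
transitivity (symmetrization u (mlform_comp T f)); first by [].
rewrite [LHS]symmetrizationE [RHS]symmetrizationE; congr (_ * _).
apply: eq_bigr => eta _; congr (u _); exact: mlform_eq.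
Qed.

Lemma symmetrization_linear m (E : lmodType R[i]) : linear (@symmetrization R m E).
Proof.
move=> a u v; apply: tensor_eq => f.
change (symmetrization (a *: u + v) f =
  a * symmetrization u f + symmetrization v f :> R[i]).
rewrite !symmetrizationE.
rewrite (eq_bigr (fun eta => a * u (mlform_perm eta f) + v (mlform_perm eta f))) //.
rewrite big_split -mulr_sumr mulrDr; congr (_ + _).
by rewrite [LHS]mulrCA.
Qed.

(** The polarization identity, read in the tensor power, writes the symmetrization
of an elementary tensor as a combination of tensor powers of sums of its
factors. *)
Lemma symmetric_symmetrization m (E : lmodType R[i]) (u : tensor m E) :
  symmetric_tensors (symmetrization u).
Proof.
move: u; apply: tensor_ind => [|a x u IH].
  rewrite (_ : symmetrization 0 = 0); first exact: lspan0.
  by apply: tensor_eq => f; rewrite symmetrizationE big1 ?mulr0.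
rewrite symmetrization_linear; apply: lspanP IH; apply: lspanZ.
rewrite (_ : \sum_eta _ =
    \sum_(S : {set 'I_m}) (-1) ^+ #|~: S| *: etensor (fun=> \sum_(i in S) x i)).
  by apply: lspan_sum => S _; apply: lspanZ; apply: lspan_gen; eexists.
apply: tensor_eq => f; rewrite /= tensor_lincombE /= polarization.
under [in LHS]eq_bigr do rewrite -[tensor_perm _ _]scale1r.
by rewrite tensor_lincombE; under eq_bigr do rewrite mul1r.
Qed.

Section PolynomialsOfTensors.
Variable E : normedModType R[i].

(** The forms [prod_form x] are invariant under permutation of their arguments. *)
Lemma poly_of_symmetrization m (u : tensor m (dual E)) :
  poly_of_tensor (symmetrization u) = poly_of_tensor u.
Proof.
apply/funext => x; rewrite /poly_of_tensor symmetrizationE.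
under eq_bigr => eta _.
  rewrite (_ : mlform_perm eta (prod_form m x) = prod_form m x); last first.
    apply: mlform_eq => g /=.
    by rewrite [RHS](reindex_inj (@perm_inj _ eta)).
  over.
rewrite sumr_const card_Sn.
transitivity ((m`!%:R)^-1 * (m`!%:R * u (prod_form m x)) : R[i]).
  by congr (_ * _); rewrite mulr_natl.
by rewrite mulrA mulVf ?mul1r // pnatr_eq0 -lt0n fact_gt0.
Qed.

Lemma poly_of_tensor_mul k l (s : tensor k (dual E)) (t : tensor l (dual E)) x :
  poly_of_tensor (tensor_mul s t) x = poly_of_tensor s x * poly_of_tensor t x.
Proof.
move: s; apply: tensor_ind => [|a g s IH]; first by rewrite mul0r.
rewrite tensor_mul_linearl.
rewrite [LHS]/(a * poly_of_tensor (tensor_mul (etensor g) t) x +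
  poly_of_tensor (tensor_mul s t) x) IH [in RHS]/poly_of_tensor.
rewrite [X in _ = X * _]/(a * \prod_i g i x + poly_of_tensor s x) mulrDl -mulrA.
congr (a * _ + _).
move: t {IH}; apply: tensor_ind => [|b h t IH]; first by rewrite mulr0.
rewrite tensor_mul_linearr.
rewrite [LHS]/(b * poly_of_tensor (tensor_mul (etensor g) (etensor h)) x +
  poly_of_tensor (tensor_mul (etensor g) t) x) IH.
rewrite [X in _ = _ * X]/(b * \prod_i h i x + poly_of_tensor t x) mulrDr mulrCA.
congr (b * _ + _).
rewrite tensor_mulE /poly_of_tensor /= big_split_ord /=; congr (_ * _).
  by apply: eq_bigr => i _; rewrite /fcat -/(unsplit (inl i)) unsplitK.
by apply: eq_bigr => i _; rewrite /fcat -/(unsplit (inr i)) unsplitK.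
Qed.

Lemma poly_of_tensor_adjoint (F : normedModType R[i]) k (T : blinop E F)
    (u : tensor k (dual F)) :
  poly_of_tensor (tensor_map (adjoint T) u) = poly_of_tensor u \o T.
Proof.
by apply/funext => x; congr (u _); exact: mlform_eq.
Qed.

End PolynomialsOfTensors.

End TensorTheory.

(** * Complete spaces and products *)

Section CompleteSpaces.
Variable R : realType.

Definition complete_space (E : normedModType R[i]) : Prop :=
  forall F : set_system E, ProperFilter F -> cauchy F -> cvg F.

Definition banach (E : normedModType R[i]) (cE : complete_space E) :
    completeNormedModType R[i] :=
  HB.pack (NormedModule.sort E) (Uniform_isComplete.Build E cE).

(** The completed structure has the carrier, operations and norm of [E], so it
is equal to [E] and not only isometric to it. Results about Banach spaces then
apply to any complete normed space by substitution. *)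
Lemma banachP (E : normedModType R[i]) :
  complete_space E -> exists E1 : completeNormedModType R[i], E = E1.
Proof.
move=> cE; exists (banach cE).
by case: E cE => T [].
Qed.

Lemma cauchy_blinop (E F : normedModType R[i]) (T : blinop E F)
  (G : set_system E) : ProperFilter G -> cauchy G -> cauchy (T @ G).
Proof.
move=> PG /rnorm_cauchyP cG; apply/cauchyP => e /gt0_complexE[-> e0].
have T1 : 0 < rnorm T + 1 by rewrite ltr_wpDl ?rnorm_ge0.
have [x Gx] := cG _ (divr_gt0 e0 T1).
exists (T x).
suff : G [set y | ball (T x) (complex.Re e)%:C (T y)] by [].
apply: filterS Gx => y /= xy.
rewrite -ball_normE /= ltr_rnormC -(raddfB T).
apply: le_lt_trans (rnorm_blinop_le _ _) _.
apply: le_lt_trans (_ : _ <= (rnorm T + 1) * rnorm (x - y)) _.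
  by rewrite ler_wpM2r ?rnorm_ge0 // lerDl.
by rewrite mulrC -ltr_pdivlMr.
Qed.

Lemma rnorm_complexE (a b : R) : rnorm (a +i* b : R[i]^o) = Num.sqrt (a ^+ 2 + b ^+ 2).
Proof. by []. Qed.

Lemma ler_norm_Re (z : R[i]^o) : `|complex.Re z| <= rnorm z.
Proof.
by case: z => a b; rewrite rnorm_complexE /= -sqrtr_sqr ler_wsqrtr // lerDl sqr_ge0.
Qed.

Lemma ler_norm_Im (z : R[i]^o) : `|complex.Im z| <= rnorm z.
Proof.
by case: z => a b; rewrite rnorm_complexE /= -sqrtr_sqr ler_wsqrtr // lerDr sqr_ge0.
Qed.

Lemma rnorm_le_ReIm (z : R[i]^o) : rnorm z <= `|complex.Re z| + `|complex.Im z|.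
Proof.
case: z => a b; rewrite rnorm_complexE /= -[leRHS]ger0_norm ?addr_ge0 //.
rewrite -sqrtr_sqr ler_wsqrtr // sqrrD !real_normK ?num_real //.
by rewrite lerD2r lerDl mulrn_wge0 // mulr_ge0.
Qed.

Lemma complex_complete : complete_space R[i]^o.
Proof.
move=> F PF /rnorm_cauchyP cF.
have cp (p : R[i] -> R) : (forall z : R[i]^o, `|p z| <= rnorm z) ->
    {morph p : x y / x - y} -> cvg (p @ F).
  move=> pz pB; apply: R_complete; apply/cauchyP => e e0.
  have [x Fx] := cF _ e0; exists (p x).
  suff : F [set y | ball (p x) e (p y)] by [].
  apply: filterS Fx => y /= xy.
  by rewrite -ball_normE /= -pB; exact: le_lt_trans (pz _) xy.
have /cvg_ex[a Fa] := cp _ ler_norm_Re (fun x y => raddfB (@complex.Re R) x y).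
have /cvg_ex[b Fb] := cp _ ler_norm_Im (fun x y => raddfB (@complex.Im R) x y).
apply/cvg_ex; exists (a +i* b); apply/rnorm_cvgP => e e0.
have e20 : 0 < e / 2 by rewrite divr_gt0.
move/cvgrPdist_lt/(_ _ e20) in Fa; move/cvgrPdist_lt/(_ _ e20) in Fb.
near=> z; apply: le_lt_trans (rnorm_le_ReIm _) _.
rewrite [ltRHS]splitr; apply: ltrD.
  by rewrite raddfB /=; near: z.
by rewrite raddfB /=; near: z.
Unshelve. all: by end_near. Qed.

Section ProductSpaces.
Variables E1 E2 : normedModType R[i].

Lemma rnorm_prodE (p : E1 * E2) : rnorm p = Num.max (rnorm p.1) (rnorm p.2).
Proof.
apply: complexI; rewrite -rnormE prod_normE !rnormE.
case: (leP (rnorm p.1) (rnorm p.2)) => [le12|lt21].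
  by rewrite max_r // lecR.
by rewrite max_l // lecR ltW.
Qed.

Lemma fst_linear : linear (@fst E1 E2).
Proof. by []. Qed.

Lemma fst_bound (p : E1 * E2) : rnorm p.1 <= 1 * rnorm p.
Proof. by rewrite mul1r rnorm_prodE le_max lexx. Qed.

Definition fst_blinop : blinop (E1 * E2)%type E1 :=
  bounded_blinop fst_linear fst_bound.

Lemma snd_linear : linear (@snd E1 E2).
Proof. by []. Qed.

Lemma snd_bound (p : E1 * E2) : rnorm p.2 <= 1 * rnorm p.
Proof. by rewrite mul1r rnorm_prodE le_max lexx orbT. Qed.

Definition snd_blinop : blinop (E1 * E2)%type E2 :=
  bounded_blinop snd_linear snd_bound.

Lemma rnorm_fst_blinop : rnorm fst_blinop <= 1.
Proof. exact: rnorm_bounded_blinop. Qed.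

Lemma rnorm_snd_blinop : rnorm snd_blinop <= 1.
Proof. exact: rnorm_bounded_blinop. Qed.

Section Pairing.
Variables (E : normedModType R[i]) (T1 : blinop E E1) (T2 : blinop E E2).

Lemma pair_linear : linear (fun x => (T1 x, T2 x)).
Proof. by move=> a x y; rewrite !linearP. Qed.

Lemma pair_bound x : rnorm (T1 x, T2 x) <= Num.max (rnorm T1) (rnorm T2) * rnorm x.
Proof.
by rewrite rnorm_prodE ge_max /= !(le_trans (rnorm_blinop_le _ _)) //
  ler_wpM2r ?rnorm_ge0 // le_max lexx ?orbT.
Qed.

Definition pair_blinop : blinop E (E1 * E2)%type :=
  bounded_blinop pair_linear pair_bound.

Lemma rnorm_pair_blinop : rnorm pair_blinop <= Num.max (rnorm T1) (rnorm T2).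
Proof. by apply: rnorm_bounded_blinop; rewrite le_max rnorm_ge0. Qed.

End Pairing.

Lemma prod_complete :
  complete_space E1 -> complete_space E2 -> complete_space (E1 * E2)%type.
Proof.
move=> c1 c2 F PF cF.
have /cvg_ex[a Fa] : cvg (fst_blinop @ F) by apply: c1; exact: cauchy_blinop.
have /cvg_ex[b Fb] : cvg (snd_blinop @ F) by apply: c2; exact: cauchy_blinop.
apply/cvg_ex; exists (a, b); apply/rnorm_cvgP => e e0.
have pFa : F [set p | rnorm (a - p.1) < e] by move/rnorm_cvgP : Fa; apply.
have pFb : F [set p | rnorm (b - p.2) < e] by move/rnorm_cvgP : Fb; apply.
apply: filterS2 pFa pFb => p /= pa pb.
by rewrite rnorm_prodE gt_max /= pa.
Qed.

End ProductSpaces.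

(** A point at distance zero from [K] is the limit in [E] of a Cauchy filter on
[K], hence belongs to [K] when [K] is complete. *)
Lemma complete_subspace_dist (E : normedModType R[i]) (K : submodClosed E) (y : E) :
  complete_space (lsubspace K) -> y \notin K ->
  exists2 r : R, 0 < r & forall x, x \in K -> r <= rnorm (y - x).
Proof.
move=> cK yK; apply: contrapT => noR; case/negP: yK.
pose G (r : R) : set (lsubspace K) := [set x | rnorm (y - inclusion K x) < r].
have FG : ProperFilter (filter_from [set r : R | 0 < r] G).
  apply: filter_from_proper.
    apply: filter_from_filter; first by exists 1 => /=.
    move=> r s r0 s0; exists (Num.min r s) => /=; first by rewrite lt_min r0.
    by move=> x; rewrite /G /= lt_min => /andP[].
  move=> r r0; apply: contrapT => rG; apply: noR; exists r => // x xK.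
  rewrite leNgt; apply/negP => yx; apply: rG.
  by exists (Lsubspace xK).
have /cvg_ex[z Gz] : cvg (filter_from [set r : R | 0 < r] G).
  apply: cK; apply/cauchyP => e /gt0_complexE[-> e0].
  have e20 : 0 < complex.Re e / 2 by rewrite divr_gt0.
  have [x Gx] : exists x, G (complex.Re e / 2) x.
    by apply: (@filter_ex _ _ FG); exists (complex.Re e / 2).
  exists x; exists (complex.Re e / 2) => // x' Gx'.
  rewrite -ball_normE /= ltr_rnormC.
  rewrite [rnorm _](_ : _ = rnorm (inclusion K x - inclusion K x')) //.
  rewrite -(subrKA y) (le_lt_trans (ler_rnormD _ _)) // [ltRHS]splitr.
  by rewrite ltrD // rnorm_distC.
suff -> : y = inclusion K z by case: z {Gz}.
apply/eqP; rewrite -subr_eq0; apply/eqP; apply: rnorm_eq0; apply/eqP.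
rewrite eq_le rnorm_ge0 andbT; apply/ler_addgt0Pl => e e0; rewrite addr0.
have e20 : 0 < e / 2 by rewrite divr_gt0.
move/rnorm_cvgP/(_ _ e20) in Gz.
have [x [/= zx yx]] : exists x, [set x | rnorm (z - x) < e / 2] x /\ G (e / 2) x.
  apply: (@filter_ex _ _ FG); apply: filterI => //.
  by exists (e / 2).
rewrite -(subrKA (inclusion K x)) (le_trans (ler_rnormD _ _)) // [leRHS]splitr.
by rewrite ltW // ltrD // rnorm_distC.
Qed.

End CompleteSpaces.

(** * Finite dimensional normed spaces *)

Section Coordinates.
Variable R : realType.

(** The finite rank decomposition of the identity is the form in which finite
dimension is used: it gives completeness, the dual space, and the dictionary
between polynomials and tensors. *)
Definition has_coordinates (E : normedModType R[i]) : Prop :=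
  exists n (w : 'I_n -> E) (phi : 'I_n -> dual E),
    forall x, x = \sum_i phi i x *: w i.

(** The coordinates of a Cauchy filter converge in the complete field [R[i]]. *)
Lemma has_coordinates_complete (E : normedModType R[i]) :
  has_coordinates E -> complete_space E.
Proof.
move=> [n [w [phi wphi]]] F PF cF.
have ca i : exists a : R[i]^o, phi i @ F --> a.
  by apply/cvg_ex; apply: complex_complete; exact: cauchy_blinop.
have [a Fa] := choice ca.
apply/cvg_ex; exists (\sum_i a i *: w i).
have -> : F = (fun x => \sum_i phi i x *: w i) @ F.
  apply/seteqP; split=> A; rewrite /fmap /=.
    by apply: filterS => x; rewrite /= -wphi.
  by apply: filterS => x; rewrite /= -wphi.
apply: cvg_big => [|i _]; first exact: add_continuous.
by apply: cvgZr_tmp; exact: Fa.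
Qed.

Lemma dual_coordinates (E : normedModType R[i]) n (w : 'I_n -> E)
    (phi : 'I_n -> dual E) (g : dual E) :
  (forall x, x = \sum_i phi i x *: w i) -> g = \sum_i g (w i) *: phi i.
Proof.
move=> wphi; apply: blinop_eq => x.
transitivity (g (\sum_i phi i x *: w i)); first by rewrite -wphi.
rewrite linear_sum.
transitivity (\sum_i g (w i) * phi i x : R[i]).
  by apply: eq_bigr => i _; rewrite linearZ mulrC.
symmetry.
exact: (big_morph (fun h : dual E => h x : R[i]) (fun u v => erefl) erefl).
Qed.

Lemma has_coordinates_dual (E : normedModType R[i]) :
  has_coordinates E -> has_coordinates (dual E).
Proof.
move=> [n [w [phi wphi]]].
exists n, phi, (fun i => evaluation (w i)) => g; exact: dual_coordinates.
Qed.

Section Kernel.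
Variables (E : lmodType R[i]) (f : E -> R[i]^o).
Hypothesis fl : linear f.

Definition kernel_pred : {pred E} := [pred x | f x == 0].

Lemma linear_form0 : f 0 = 0.
Proof. by have := fl (-1) 0 0; rewrite !scaleN1r addrC subrr addrC subrr. Qed.

Lemma kernel_submod_closed : submod_closed kernel_pred.
Proof.
split=> [|a x y]; rewrite !inE ?linear_form0 // => /eqP x0 /eqP y0.
by rewrite fl x0 y0 scaler0 addr0.
Qed.

Definition kernel : submodClosed E :=
  HB.pack kernel_pred (GRing.isSubmodClosed.Build R[i] E kernel_pred kernel_submod_closed).

Lemma in_kernel x : (x \in kernel) = (f x == 0).
Proof. by []. Qed.

End Kernel.

(** If [f y = 1] and [y] has distance at least [r] from the kernel of [f], then for
[f x != 0] the vector [y - x / f x] is in the kernel, so that the norm of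
[x / f x] is at least [r]; hence [f] is bounded by [1 / r]. If [f] is zero, the
zero vector serves as [y]. *)
Lemma linear_form_bounded (E : normedModType R[i]) (f : E -> R[i]^o) (fl : linear f) :
  complete_space (lsubspace (kernel fl)) ->
  exists (g : dual E) (y : E), g =1 f /\ forall x, f (x - f x *: y) = 0.
Proof.
move=> cK; have f0 := linear_form0 fl.
have fZ a x : f (a *: x) = a * f x by rewrite -[a *: x]addr0 fl f0 addr0.
have fB x z : f (x - z) = f x - f z.
  by rewrite addrC -scaleN1r fl scaleN1r addrC.
have [fx0|/existsNP[y1 /eqP fy1]] := pselect (forall x, f x = 0).
  by exists 0, 0; split=> // x; rewrite fx0.
pose y := (f y1)^-1 *: y1.
have fy : f y = 1 by rewrite fZ mulVf.
have yK : y \notin kernel fl by rewrite in_kernel fy oner_eq0.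
have [r r0 ry] := complete_subspace_dist cK yK.
have fb x : rnorm (f x) <= r^-1 * rnorm x.
  have [->|fx] := eqVneq (f x) 0.
    by rewrite rnorm0 mulr_ge0 ?rnorm_ge0 // invr_ge0 ltW.
  have xK : y - (f x)^-1 *: x \in kernel fl.
    by rewrite in_kernel fB fy fZ mulVf // subrr.
  have := ry _ xK; rewrite subKr => rx.
  rewrite ler_pdivlMl // mulrC -[in leRHS](scalerKV fx x) rnormZ.
  by rewrite ler_wpM2l ?rnorm_ge0.
exists (bounded_blinop fl fb), y; split=> // x.
by rewrite fB fZ fy mulr1 subrr.
Qed.

(** Induction on the number of forms. The kernel of the first form has coordinates
by induction, hence is complete, hence this form is continuous; then
[x |-> x - f0 x *: y] is a continuous projection onto the kernel, along which
the coordinates of the kernel are pulled back. *)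
Lemma has_coordinates_separating n : forall (E : normedModType R[i])
  (f : 'I_n -> E -> R[i]^o), (forall i, linear (f i)) ->
  (forall x, (forall i, f i x = 0) -> x = 0) -> has_coordinates E.
Proof.
elim: n => [|n IH] E f fl fsep.
  exists 0%N, (fun=> 0), (fun=> 0) => x; rewrite big_ord0.
  by apply: fsep => -[].
pose K := kernel (fl ord0).
have [m [w [phi wphi]]] : has_coordinates (lsubspace K).
  apply: (IH _ (fun i x => f (lift ord0 i) (inclusion K x))) => [i a x y|x fx].
    by rewrite linearP fl.
  apply: val_inj; apply: fsep => i; case: (unliftP ord0 i) => [j ->|->].
    exact: fx.
  by case: x {fx} => x /= /eqP.
have cK : complete_space (lsubspace K).
  by apply: has_coordinates_complete; exists m, w, phi.
have [g [y [gf fy]]] := linear_form_bounded cK.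
have pl : linear (fun x => x - g x *: y).
  move=> a x z; rewrite linearP scalerBr scalerDl !scalerA opprD addrACA.
  by [].
have pb x : rnorm (x - g x *: y) <= (1 + rnorm g * rnorm y) * rnorm x.
  rewrite (le_trans (ler_rnormD _ _)) // rnormN rnormZ mulrDl mul1r lerD2l.
  by rewrite mulrAC ler_wpM2r ?rnorm_ge0 // rnorm_blinop_le.
pose p := bounded_blinop pl pb.
have pK x : p x \in K by rewrite in_kernel /= gf fy.
exists m.+1, (cons_fun y (fun i => inclusion K (w i))),
  (cons_fun g (fun i => comp_blinop (phi i) (corestrict pK))) => x.
rewrite big_ord_recl /cons_fun unlift_none /=.
under eq_bigr => i _ do rewrite liftK /=.
have := congr1 (inclusion K) (wphi (corestrict pK x)).
rewrite inclusion_corestrict linear_sum => px.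
transitivity (g x *: y + p x); first by rewrite /= addrC subrK.
by rewrite px; congr (_ + _); apply: eq_bigr => i _; rewrite linearZ.
Qed.

Lemma lspan_rangeP (E : lmodType R[i]) n (v : 'I_n -> E) x :
  lspan (range v) x <-> exists c : 'I_n -> R[i], x = \sum_i c i *: v i.
Proof.
split=> [|[c ->]]; last first.
  by apply: lspan_sum => i _; apply: lspanZ; apply: lspan_gen; exists i.
move: x; apply: lspan_ind.
  by exists (fun=> 0); rewrite big1 // => i _; rewrite scale0r.
move=> a _ _ [i _ <-] [c ->]; exists (fun j => a * (j == i)%:R + c j).
under [RHS]eq_bigr do rewrite scalerDl.
rewrite big_split /=; congr (_ + _); rewrite (bigD1 i) //= eqxx mulr1 big1 ?addr0 //.
by move=> j /negPf ->; rewrite mulr0 scale0r.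
Qed.

(** The members of [v] may lie outside [N] and be linearly dependent. A dependent
family is shortened until it is independent, and the coefficients of the
elements of [N] are then the forms. *)
Lemma finite_dim_separating (E : normedModType R[i]) (N : submodClosed E) n :
  forall v : 'I_n -> E, [set` N] `<=` lspan (range v) ->
  exists m (f : 'I_m -> lsubspace N -> R[i]^o), (forall i, linear (f i)) /\
    (forall x, (forall i, f i x = 0) -> x = 0).
Proof.
elim: n => [|n IH] v Nv.
  exists 0%N, (fun _ _ => 0); split=> [[]//|x _]; apply: val_inj.
  have /lspan_rangeP[c] : lspan (range v) (val x) by apply: Nv; exact: valP.
  by rewrite big_ord0.
have [vfree|] := pselect (forall c, \sum_i c i *: v i = 0 -> forall i, c i = 0).
  have cx (x : lsubspace N) : exists c : 'I_n.+1 -> R[i]^o, val x = \sum_i c i *: v i.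
    by apply/lspan_rangeP/Nv; exact: valP.
  have [c cP] := choice cx.
  exists n.+1, (fun i x => c x i); split=> [i a x y|x cx0].
    apply/eqP; rewrite -subr_eq0; apply/eqP.
    apply: (vfree (fun i => c (a *: x + y) i - (a * c x i + c y i))) i.
    under eq_bigr do rewrite scalerBl scalerDl -scalerA.
    rewrite big_split sumrN big_split /= -scaler_sumr -!cP.
    exact: subrr.
  by apply: val_inj; rewrite cP big1 // => i _; rewrite cx0 scale0r.
move=> /existsNP[c /not_implyP[vc /existsNP[j /eqP cj]]].
apply: (IH (v \o lift j)) => x /Nv /lspan_rangeP[d ->].
apply: lspan_sum => i _; apply: lspanZ.
case: (unliftP j i) => [i' ->|->]; first by apply: lspan_gen; exists i'.
move: vc; rewrite (bigD1_ord j) //= => /eqP; rewrite addr_eq0 => /eqP cv.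
rewrite -[v j](scalerK cj) cv; apply: lspanZ; rewrite -sumrN.
apply: lspan_sum => i' _; rewrite -scaleNr; apply: lspanZ.
by apply: lspan_gen; exists i'.
Qed.

Lemma finite_dim_coordinates (E : normedModType R[i]) (N : submodClosed E) :
  finite_dim N -> has_coordinates (lsubspace N).
Proof.
move=> [n [v Nv]]; have [m [f [fl fsep]]] := finite_dim_separating Nv.
exact: has_coordinates_separating fl fsep.
Qed.

End Coordinates.

(** * Homogeneous polynomials and symmetric tensors *)

Section PolynomialTensorCorrespondence.
Variables (R : realType).

Lemma multilinear_prod k (V : lmodType R[i]) (L : 'I_k -> V -> R[i]^o) :
  (forall j, linear (L j)) ->
  multilinear (fun x : 'I_k -> V => \prod_j L j (x j) : R[i]^o).
Proof.
move=> Ll i x a u v; have prodE w :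
    \prod_j L j (upd x i w j) = L i w * \prod_(j | j != i) L j (x j) :> R[i].
  rewrite (bigD1 i) //= {1}/upd eqxx; congr (_ * _).
  by apply: eq_bigr => j /negPf ji; rewrite /upd ji.
by rewrite !prodE Ll mulrDl /GRing.scale /= mulrA.
Qed.

Section EvaluationForm.
Variables (k : nat) (E : normedModType R[i]).

(** With a constant family of points this is [prod_form]; with distinct points it
is a polarized version of it. *)
Definition eval_form (y : 'I_k -> E) : mlform k (dual E) :=
  MLForm (multilinear_prod (fun j => evaluation_linear (y j))).

Definition power_form (g : dual E) : mlform k E :=
  MLForm (multilinear_prod (fun _ : 'I_k => blinop_linear g)).

Lemma eval_form_const (x : E) : eval_form (fun=> x) = prod_form k x.
Proof. exact: mlform_eq. Qed.

Lemma eval_form_polarization (u : tensor k (dual E)) (y : 'I_k -> E) :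
  symmetric_tensors u ->
  k`!%:R * u (eval_form y) =
  \sum_(S : {set 'I_k}) (-1) ^+ #|~: S| * poly_of_tensor u (\sum_(i in S) y i) :> R[i].
Proof.
move: u; apply: symmetric_tensors_ind => [|a g u IH].
  by rewrite mulr0 big1 // => S _; rewrite mulr0.
rewrite [X in _ * X]/(a * \prod_j g (y j) + u (eval_form y)) mulrDr IH mulrCA.
have -> : k`!%:R * \prod_j g (y j) = \sum_(eta : 'S_k) \prod_j g (y (eta j)) :> R[i].
  rewrite [RHS](eq_bigr (fun=> \prod_j g (y j))) => [|eta _].
    by rewrite sumr_const card_Sn mulr_natl.
  by rewrite [RHS](reindex_inj (@perm_inj _ eta)).
rewrite -(polarization (power_form g) y) mulr_sumr -big_split.
apply: eq_bigr => S _ /=.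
rewrite [X in _ = _ * X]/(a * \prod_(j < k) g (\sum_(i in S) y i) +
  poly_of_tensor u (\sum_(i in S) y i)).
by rewrite mulrDr; congr (_ + _); rewrite mulrCA.
Qed.

(** A multilinear form on the dual is determined by its values on the coordinate
functionals, so that a tensor is determined by its values on the forms
[eval_form]. *)
Lemma tensor_coordinates n (w : 'I_n -> E) (phi : 'I_n -> dual E)
    (u : tensor k (dual E)) (f : mlform k (dual E)) :
  (forall x, x = \sum_i phi i x *: w i) ->
  u f = \sum_(g : {ffun 'I_k -> 'I_n}) u (eval_form (w \o g)) * f (phi \o g) :> R[i].
Proof.
move=> wphi; move: u; apply: tensor_ind => [|a h u IH].
  by rewrite big1 // => g _; rewrite mul0r.
transitivity (a * f h + u f : R[i]); first by [].
rewrite IH.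
have hE : h = fun j => \sum_i h j (w i) *: phi i.
  by apply/funext => j; exact: dual_coordinates.
rewrite {1}hE (mlform_lincomb f (fun j i => h j (w i)) (fun=> phi)).
rewrite mulr_sumr -big_split; apply: eq_bigr => g _.
by rewrite mulrA; symmetry; exact: mulrDl.
Qed.

(** A symmetric tensor takes the values on the forms [eval_form] that the
polarization identity computes from its polynomial
([eval_form_polarization]), and these values determine the tensor
([tensor_coordinates]). *)
Lemma poly_of_tensor_inj (u v : tensor k (dual E)) : has_coordinates E ->
  symmetric_tensors u -> symmetric_tensors v ->
  poly_of_tensor u = poly_of_tensor v -> u = v.
Proof.
move=> [n [w [phi wphi]]] us vs uv; apply: tensor_eq => f.
rewrite (tensor_coordinates u f wphi) (tensor_coordinates v f wphi).
apply: eq_bigr => g _; congr (_ * _).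
have k0 : k`!%:R != 0 :> R[i] by rewrite pnatr_eq0 -lt0n fact_gt0.
by apply: (mulfI k0); rewrite !eval_form_polarization // uv.
Qed.

(** The tensor is read off from the expansion of the multilinear form of [P] in
coordinates, then symmetrized, which does not change the polynomial. *)
Lemma poly_of_tensor_surj (P : E -> R[i]^o) : has_coordinates E ->
  homogeneous_polynomial k P ->
  exists2 u : tensor k (dual E), symmetric_tensors u & poly_of_tensor u = P.
Proof.
move=> [n [w [phi wphi]]] [[A PA] _].
pose u : tensor k (dual E) :=
  \sum_(g : {ffun 'I_k -> 'I_n}) A (w \o g) *: etensor (phi \o g).
exists (symmetrization u); first exact: symmetric_symmetrization.
rewrite poly_of_symmetrization; apply/funext => x.
rewrite /poly_of_tensor tensor_lincombE PA [in RHS](wphi x).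
rewrite (mlform_lincomb A (fun _ i => phi i x) (fun=> w)).
by apply: eq_bigr => g _; rewrite mulrC.
Qed.

Lemma symmetric_tensor_of_poly (P : E -> R[i]^o) :
  symmetric_tensors (tensor_of_poly k P).
Proof.
rewrite /tensor_of_poly; case: xgetP => [u _ []//|_]; exact: lspan0.
Qed.

Lemma tensor_of_polyK (P : E -> R[i]^o) : has_coordinates E ->
  homogeneous_polynomial k P -> poly_of_tensor (tensor_of_poly k P) = P.
Proof.
move=> cE hP; have [u us uP] := poly_of_tensor_surj cE hP.
by have [] := xgetPex 0 (ex_intro [set u | _ /\ _] u (conj us uP)).
Qed.

Lemma poly_of_tensorK (u : tensor k (dual E)) (P : E -> R[i]^o) :
  has_coordinates E -> symmetric_tensors u -> poly_of_tensor u = P ->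
  tensor_of_poly k P = u.
Proof.
move=> cE us uP; apply: xget_unique; first by split.
by move=> v [vs vP]; apply: poly_of_tensor_inj; rewrite ?uP.
Qed.

Lemma homogeneous_poly_of_tensor (u : tensor k (dual E)) :
  homogeneous_polynomial k (poly_of_tensor u).
Proof.
split.
  have fP : multilinear (fun y : 'I_k -> E => u (eval_form y)).
    move=> i y a x1 x2; move: u; apply: tensor_ind => [|b h u IH].
      by rewrite [LHS]/(0 : R[i]) scaler0 addr0.
    have prodE x : (b *: etensor h + u) (eval_form (upd y i x)) =
        b * (\prod_j h j (upd y i x j)) + u (eval_form (upd y i x)) :> R[i] by [].
    rewrite !prodE IH (multilinear_prod (fun j => blinop_linear (h j))).
    by rewrite /GRing.scale /= !mulrDr addrACA mulrCA.
  by exists (MLForm fP) => x; rewrite /= eval_form_const.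
move: u; apply: tensor_ind => [x|a h u IH x]; first exact: cvg_cst.
apply: cvgD; last exact: IH.
apply: cvgZl_tmp; apply: cvg_big => [|i _]; first exact: mul_continuous.
exact: blinop_continuous.
Qed.

End EvaluationForm.

Lemma homogeneous_mul k l (E : normedModType R[i]) (P Q : E -> R[i]^o) :
  homogeneous_polynomial k P -> homogeneous_polynomial l Q ->
  homogeneous_polynomial (k + l) (fun x => P x * Q x).
Proof.
move=> [[A PA] Pc] [[B QB] Qc]; split; last first.
  by move=> x; apply: cvgM; [exact: Pc|exact: Qc].
have fP : multilinear (fun y : 'I_(k + l) -> E =>
    A (y \o lshift l) * B (y \o @rshift k l) : R[i]^o).
  move=> i y a x1 x2.
  have updE (p q : nat) (h : 'I_p -> 'I_q) (hi : injective h) (z : 'I_q -> E) j u :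
      upd z (h j) u \o h = upd (z \o h) j u.
    by apply/funext => j'; rewrite /upd /= (inj_eq hi).
  have updN (p q : nat) (h : 'I_p -> 'I_q) (z : 'I_q -> E) m u :
      (forall j, h j != m) -> upd z m u \o h = z \o h.
    by move=> hm; apply/funext => j'; rewrite /upd /= (negPf (hm _)).
  case: (split_ordP i) => j ->.
    have rl m : rshift k m != lshift l j by rewrite eq_rlshift.
    rewrite !(updE _ _ _ (@lshift_inj k l)) !(updN _ _ _ _ _ _ rl) mlformP.
    by rewrite /GRing.scale /= mulrDl mulrA.
  have lr m : lshift l m != rshift k j by rewrite eq_lrshift.
  rewrite !(updE _ _ _ (@rshift_inj k l)) !(updN _ _ _ _ _ _ lr) mlformP.
  by rewrite /GRing.scale /= mulrDr mulrCA.
by exists (MLForm fP) => x; rewrite PA QB.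
Qed.

Lemma homogeneous_comp k (E F : normedModType R[i]) (T : blinop E F) (Q : F -> R[i]^o) :
  homogeneous_polynomial k Q -> homogeneous_polynomial k (Q \o T).
Proof.
move=> [[A QA] Qc]; split; first by exists (mlform_comp T A) => x /=; rewrite QA.
by move=> x; apply: continuous_comp; [exact: blinop_continuous|exact: Qc].
Qed.

End PolynomialTensorCorrespondence.

(** * Maximal and minimal norms *)

Section SpanSubspaces.
Variables (R : realType) (E : normedModType R[i]) (n : nat) (v : 'I_n -> E).

Definition span_pred : {pred E} := [pred x | `[< lspan (range v) x >]].

Lemma span_submod_closed : submod_closed span_pred.
Proof.
split=> [|a x y]; rewrite !inE; first exact: lspan0.
exact: lspanP.
Qed.

Definition span_subspace : submodClosed E :=
  HB.pack span_pred (GRing.isSubmodClosed.Build R[i] E span_pred span_submod_closed).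

Lemma in_span x : (x \in span_subspace) <-> lspan (range v) x.
Proof. by rewrite inE. Qed.

Lemma finite_dim_span : finite_dim span_subspace.
Proof. by exists n, v => x /in_span. Qed.

End SpanSubspaces.

Section TensorNormTheory.
Variables (R : realType) (k : nat) (alpha : tensor_norm_fun R k).
Hypothesis alpha_norm : is_symmetric_tensor_norm alpha.

Lemma tensor_norm0 (E : normedModType R[i]) : alpha (0 : tensor k E) = 0.
Proof.
have := tensor_normZ alpha_norm 0 (lspan0 _ : @symmetric_tensors R k E 0).
by rewrite scale0r rnorm0 mul0r.
Qed.

Lemma tensor_norm_ge0 (E : normedModType R[i]) (s : tensor k E) :
  symmetric_tensors s -> 0 <= alpha s.
Proof.
move=> ss; have nsE : alpha (- s) = alpha s.
  rewrite -scaleN1r (tensor_normZ alpha_norm) // rnormN.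
  by rewrite (_ : rnorm _ = 1) ?mul1r // /rnorm normr1.
have := tensor_normD alpha_norm ss (lspanZ (-1) ss : symmetric_tensors (-1 *: s)).
rewrite scaleN1r nsE subrr tensor_norm0 -mulr2n -mulr_natl pmulr_rge0 //.
Qed.

Lemma tensor_norm_contraction (E F : normedModType R[i]) (T : blinop E F)
    (s : tensor k E) : rnorm T <= 1 -> symmetric_tensors s ->
  alpha (tensor_map T s) <= alpha s.
Proof.
move=> T1 ss; apply: le_trans (tensor_norm_map alpha_norm T ss) _.
by rewrite ler_piMl ?tensor_norm_ge0 // exprn_ile1 ?rnorm_ge0.
Qed.

Lemma le_max_norm (E : normedModType R[i]) (P : E -> R[i]^o) (N : submodClosed E) :
  finite_dim N ->
  ((alpha (tensor_of_poly k (P \o inclusion N)))%:E <= max_norm alpha P)%E.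
Proof. by move=> fN; apply: ereal_sup_ubound; exists N. Qed.

Lemma max_norm_le (E : normedModType R[i]) (P : E -> R[i]^o) (b : \bar R) :
  (forall N : submodClosed E, finite_dim N ->
    ((alpha (tensor_of_poly k (P \o inclusion N)))%:E <= b)%E) ->
  (max_norm alpha P <= b)%E.
Proof. by move=> Nb; apply: ge_ereal_sup => _ [N fN ->]; exact: Nb. Qed.

Lemma max_norm_ge0 (E : normedModType R[i]) (P : E -> R[i]^o) :
  (0 <= max_norm alpha P)%E.
Proof.
have fN := finite_dim_span (fun _ : 'I_0 => 0 : E).
apply: le_trans (le_max_norm P fN); rewrite lee_fin.
by apply: tensor_norm_ge0; exact: symmetric_tensor_of_poly.
Qed.

Lemma max_norm_fin (E : normedModType R[i]) (P : E -> R[i]^o) :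
  max_ideal alpha P -> max_norm alpha P \is a fin_num.
Proof. by move=> [_ P_oo]; rewrite ge0_fin_numE ?max_norm_ge0. Qed.

(** Restricting to [N] acts on tensors as the transpose of the inclusion of [N],
which is a contraction. *)
Lemma max_norm_poly_of_tensor (E : normedModType R[i]) (u : tensor k (dual E)) :
  symmetric_tensors u -> (max_norm alpha (poly_of_tensor u) <= (alpha u)%:E)%E.
Proof.
move=> us; apply: max_norm_le => N fN; rewrite lee_fin.
rewrite -(poly_of_tensor_adjoint (inclusion N)).
rewrite (poly_of_tensorK (u := tensor_map (adjoint (inclusion N)) u)) //.
- apply: tensor_norm_contraction => //.
  exact: le_trans (rnorm_adjoint _) (rnorm_inclusion _).
- exact: finite_dim_coordinates.
- exact: symmetric_tensor_map.
Qed.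

Lemma max_ideal_poly_of_tensor (E : normedModType R[i]) (u : tensor k (dual E)) :
  symmetric_tensors u -> max_ideal alpha (poly_of_tensor u).
Proof.
move=> us; split; first exact: homogeneous_poly_of_tensor.
by apply: le_lt_trans (max_norm_poly_of_tensor us) _; rewrite ltry.
Qed.

(** The space [E] is one of its own finite dimensional subspaces. The subspace is
a different type than [E], hence the two transposed identifications, both
contractions. *)
Lemma tensor_norm_le_max_norm (E : normedModType R[i]) (u : tensor k (dual E)) :
  has_coordinates E -> symmetric_tensors u ->
  ((alpha u)%:E <= max_norm alpha (poly_of_tensor u))%E.
Proof.
move=> [n [w [phi wphi]]] us; pose N := span_subspace w.
have id_bound x : rnorm (idfun x : E) <= 1 * rnorm x by rewrite mul1r.
pose I := bounded_blinop (fun a x y => erefl : idfun (a *: x + y) = _) id_bound.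
have IN x : I x \in N.
  apply/in_span; rewrite [I x]wphi; apply: lspan_sum => i _; apply: lspanZ.
  by apply: lspan_gen; exists i.
pose J := corestrict IN.
apply: le_trans (le_max_norm _ (finite_dim_span w)); rewrite lee_fin.
rewrite -(poly_of_tensor_adjoint (inclusion N)).
have us' := symmetric_tensor_map (adjoint (inclusion N)) us.
rewrite (poly_of_tensorK _ us') //; last exact/finite_dim_coordinates/finite_dim_span.
have uE : tensor_map (adjoint J) (tensor_map (adjoint (inclusion N)) u) = u.
  rewrite (tensor_map_comp (U := idfun)) ?tensor_map_id // => g.
  exact: blinop_eq.
rewrite -{1}uE; apply: tensor_norm_contraction us'.
apply: le_trans (rnorm_adjoint _) (le_trans (rnorm_corestrict _) _).
exact: rnorm_bounded_blinop.
Qed.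

(** The restriction of [Q \o T] to [N] is the restriction of [Q] to a finite
dimensional subspace that contains [T N], composed with [T]; the metric mapping
property is applied to the transpose of [T]. *)
Lemma max_norm_comp (E F : normedModType R[i]) (T : blinop E F) (Q : F -> R[i]^o) :
  max_ideal alpha Q ->
  (max_norm alpha (Q \o T) <= max_norm alpha Q * (rnorm T ^+ k)%:E)%E.
Proof.
move=> mQ; have hQ := mQ.1; apply: max_norm_le => N fN.
have [n [v Nv]] := fN.
pose M := span_subspace (T \o v).
have TM x : comp_blinop T (inclusion N) x \in M.
  apply/in_span.
  have /lspan_rangeP[c xc] : lspan (range v) (val x) by apply: Nv; exact: valP.
  apply/lspan_rangeP; exists c; transitivity (T (val x)) => //; rewrite xc (linear_sum T).
  by apply: eq_bigr => i _; rewrite linearZ.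
pose S := corestrict TM.
have fM : finite_dim M := finite_dim_span _.
have us := symmetric_tensor_of_poly k (Q \o inclusion M).
have uQ := tensor_of_polyK (finite_dim_coordinates fM) (homogeneous_comp (inclusion M) hQ).
rewrite (poly_of_tensorK (u := tensor_map (adjoint S) (tensor_of_poly k (Q \o inclusion M)))).
- rewrite -(fineK (max_norm_fin mQ)) -EFinM lee_fin mulrC.
  apply: le_trans (tensor_norm_map alpha_norm _ us) _.
  apply: ler_pM; rewrite ?exprn_ge0 ?rnorm_ge0 ?tensor_norm_ge0 //.
    rewrite lerXn2r ?nnegrE ?rnorm_ge0 //.
    apply: le_trans (rnorm_adjoint _) (le_trans (rnorm_corestrict _) _).
    apply: le_trans (rnorm_comp_blinop _ _) _.
    by rewrite ler_piMr ?rnorm_ge0 ?rnorm_inclusion.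
  by rewrite -lee_fin fineK ?max_norm_fin // le_max_norm.
- exact: finite_dim_coordinates.
- exact: symmetric_tensor_map.
- by rewrite poly_of_tensor_adjoint uQ.
Qed.

Lemma max_ideal_comp (E F : normedModType R[i]) (T : blinop E F) (Q : F -> R[i]^o) :
  max_ideal alpha Q -> max_ideal alpha (Q \o T).
Proof.
move=> mQ; split; first exact: homogeneous_comp mQ.1.
apply: le_lt_trans (max_norm_comp T mQ) _.
by rewrite -(fineK (max_norm_fin mQ)) -EFinM ltry.
Qed.

Lemma max_norm_le_min_norm (E : normedModType R[i]) (P : E -> R[i]^o) :
  (max_norm alpha P <= min_norm alpha P)%E.
Proof.
apply: le_ereal_inf_tmp => _ [E1 [T [Q [[_ mQ ->] ->]]]].
exact: max_norm_comp.
Qed.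

Lemma min_norm_ge0 (E : normedModType R[i]) (P : E -> R[i]^o) :
  (0 <= min_norm alpha P)%E.
Proof. exact: le_trans (max_norm_ge0 P) (max_norm_le_min_norm P). Qed.

Lemma min_norm_le (E : normedModType R[i]) (P : E -> R[i]^o)
    (E1 : completeNormedModType R[i]) (T : blinop E E1) (Q : E1 -> R[i]^o) :
  min_factorization alpha P T Q ->
  (min_norm alpha P <= max_norm alpha Q * (rnorm T ^+ k)%:E)%E.
Proof. by move=> PTQ; apply: ereal_inf_lbound; exists E1, T, Q. Qed.

Lemma min_norm_fin (E : normedModType R[i]) (P : E -> R[i]^o) :
  min_ideal alpha P -> min_norm alpha P \is a fin_num.
Proof.
move=> [E1 [T [Q fact]]]; rewrite ge0_fin_numE ?min_norm_ge0 //.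
apply: le_lt_trans (min_norm_le fact) _; have [_ mQ _] := fact.
by rewrite -(fineK (max_norm_fin mQ)) -EFinM ltry.
Qed.

(** The minimal ideal asks for factorizations through Banach spaces; this is the
case of a complete normed space given without its Banach space structure. *)
Lemma min_ideal_contraction (E F : normedModType R[i]) (T : blinop E F)
    (Q : F -> R[i]^o) :
  complete_space F -> approximable T -> rnorm T <= 1 -> max_ideal alpha Q ->
  min_ideal alpha (Q \o T) /\ (min_norm alpha (Q \o T) <= max_norm alpha Q)%E.
Proof.
move=> /banachP[E1 EE1]; subst F => aT T1 mQ.
have fact : min_factorization alpha (Q \o T) T Q by [].
split; first by exists E1, T, Q.
apply: le_trans (min_norm_le fact) _.
by rewrite -[leRHS]mule1 lee_wpmul2l ?max_norm_ge0 // lee_fin exprn_ile1 ?rnorm_ge0.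
Qed.

Lemma min_ideal_finite_dim (E : normedModType R[i]) (P : E -> R[i]^o) :
  has_coordinates E -> max_ideal alpha P ->
  min_ideal alpha P /\ (min_norm alpha P <= max_norm alpha P)%E.
Proof.
move=> cE mP; have [n [w [phi wphi]]] := cE.
have id_bound x : rnorm (idfun x : E) <= 1 * rnorm x by rewrite mul1r.
pose I := bounded_blinop (fun a x y => erefl : idfun (a *: x + y) = _) id_bound.
apply: (min_ideal_contraction (T := I)) => //.
- exact: has_coordinates_complete.
- apply: subset_closure; exists n, w => _ [x _ <-].
  rewrite [I x]wphi; apply: lspan_sum => i _; apply: lspanZ.
  by apply: lspan_gen; exists i.
- exact: rnorm_bounded_blinop.
Qed.

(** The infimum in the definition of a finitely generated norm is over a nonempty
set: a symmetric tensor lives over the span of the vectors in any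
representation of it. *)
Lemma finitely_generated_approx (E : normedModType R[i]) (s : tensor k E) (e : R) :
  finitely_generated alpha -> symmetric_tensors s -> 0 < e ->
  exists (N : submodClosed E) (s' : tensor k (lsubspace N)),
    [/\ finite_dim N, symmetric_tensors s', tensor_map (inclusion N) s' = s
      & alpha s' < alpha s + e].
Proof.
move=> fg ss e0; rewrite (fg _ _ ss).
have := inf_adherent e0 (_ : has_inf [set r | exists (N : submodClosed E) (s' : tensor k (lsubspace N)),
    [/\ finite_dim N, symmetric_tensors s', tensor_map (inclusion N) s' = s
      & r = alpha s']]).
case; last first.
  by move=> _ [N [s' [fN ss' ms ->]]] lt_e; exists N, s'; split.
split; last by exists 0 => _ [N [s' [_ ss' _ ->]]]; exact: tensor_norm_ge0.
have [n [c [w [wE sE]]]] := ss.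
have wE' i : exists x : E, etensor (fun=> x) = w i.
  by have [x _ <-] := wE i; exists x.
have [v vE] := choice wE'.
pose N := span_subspace v.
have vN i : v i \in N by apply/in_span/lspan_gen; exists i.
pose s' : tensor k (lsubspace N) := \sum_i c i *: etensor (fun=> Lsubspace (vN i)).
exists (alpha s'), N, s'; split=> //.
- exact: finite_dim_span.
- by exists n, c, (fun i => etensor (fun=> Lsubspace (vN i))); split=> // i; eexists.
rewrite sE; apply: tensor_eq => f; rewrite tensor_lincombE.
rewrite [LHS](tensor_lincombE _ _ _ (mlform_comp (inclusion N) f)).
apply: eq_bigr => i _; congr (_ * _).
by rewrite -(vE i).
Qed.

End TensorNormTheory.

(** * Approximable operators *)

Section ApproximableOperators.
Variables (R : realType).

Lemma approximableP (E F : normedModType R[i]) (T : blinop E F) :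
  approximable T <->
  forall e : R, 0 < e -> exists2 S, @finite_rank R E F S & rnorm (T - S) < e.
Proof.
split=> [cT e e0|H B /nbhs_ballP[e /gt0_complexE[-> e0]] TB].
  have e0C : 0 < e%:C :> R[i] by rewrite ltcR.
  have [S [fS]] := cT _ (nbhsx_ballx T _ e0C).
  by rewrite -ball_normE /= ltr_rnormC; exists S.
have [S fS TS] := H _ e0; exists S; split=> //; apply: TB.
by rewrite -ball_normE /= ltr_rnormC.
Qed.

Lemma approximableZ (E F : normedModType R[i]) (a : R[i]) (T : blinop E F) :
  approximable T -> approximable (a *: T).
Proof.
move=> /approximableP aT; apply/approximableP => e e0.
have a1 : 0 < rnorm (a : R[i]^o) + 1 by rewrite ltr_wpDl ?rnorm_ge0.
have [S [n [v Sv]] TS] := aT _ (divr_gt0 e0 a1).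
exists (a *: S).
  exists n, v => _ [x _ <-]; apply: (lspanZ a); apply: Sv; by exists x.
rewrite -scalerBr (rnormZ a) (le_lt_trans (_ : _ <= (rnorm (a : R[i]^o) + 1) * rnorm (T - S))) //.
  by rewrite ler_wpM2r ?rnorm_ge0 // lerDl.
by rewrite mulrC -ltr_pdivlMr.
Qed.

Lemma approximable_pair (E E1 E2 : normedModType R[i]) (T1 : blinop E E1)
    (T2 : blinop E E2) :
  approximable T1 -> approximable T2 -> approximable (pair_blinop T1 T2).
Proof.
move=> /approximableP a1 /approximableP a2; apply/approximableP => e e0.
have [S1 [n1 [v1 Sv1]] TS1] := a1 _ e0.
have [S2 [n2 [v2 Sv2]] TS2] := a2 _ e0.
exists (pair_blinop S1 S2).
  exists (n1 + n2)%N, (fun i => match fintype.split i with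
    inl j => (v1 j, 0) | inr j => (0, v2 j) end) => _ [x _ <-].
  have /lspan_rangeP[c1 c1E] : lspan (range v1) (S1 x) by apply: Sv1; exists x.
  have /lspan_rangeP[c2 c2E] : lspan (range v2) (S2 x) by apply: Sv2; exists x.
  apply/lspan_rangeP.
  exists (fun i => match fintype.split i with inl j => c1 j | inr j => c2 j end).
  rewrite big_split_ord /=.
  under eq_bigr => i _ do rewrite -/(unsplit (inl i)) unsplitK.
  under [X in _ = _ + X]eq_bigr => i _ do rewrite -/(unsplit (inr i)) unsplitK.
  apply: injective_projections => /=.
    rewrite c1E !raddf_sum /= [X in _ + X]big1 ?addr0 // => i _.
    by rewrite scaler0.
  rewrite c2E !raddf_sum /= [X in X + _]big1 ?add0r // => i _.
  by rewrite scaler0.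
have -> : pair_blinop T1 T2 - pair_blinop S1 S2 = pair_blinop (T1 - S1) (T2 - S2).
  exact: blinop_eq.
by apply: le_lt_trans (rnorm_pair_blinop _ _) _; rewrite gt_max TS1.
Qed.

End ApproximableOperators.

(** * Two estimates on real numbers *)

Section RealEstimates.
Variable R : realType.

Lemma le_mul_adherent (m c p q : R) : 0 < c -> 0 <= p -> 0 <= q ->
  (forall e, 0 < e -> m <= c * (p + e) * (q + e)) -> m <= c * p * q.
Proof.
move=> c0 p0 q0 H; rewrite leNgt; apply/negP => m_gt.
pose d := m - c * p * q; have d0 : 0 < d by rewrite subr_gt0.
pose K := c * (p + q + 1).
have K0 : 0 < K by rewrite mulr_gt0 // ltr_wpDl ?addr_ge0.
pose e := Num.min 1 (d / (2 * K)).
have dK : 0 < d / (2 * K) by rewrite divr_gt0 // mulr_gt0.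
have e0 : 0 < e by rewrite lt_min ltr01 dK.
have e1 : e <= 1 by rewrite ge_min lexx.
have ed : e <= d / (2 * K) by rewrite ge_min lexx orbT.
have eK : e * (2 * K) <= d by rewrite -ler_pdivlMr // mulr_gt0.
have := H _ e0; rewrite leNgt => /negP; apply.
have ceq : c * (p + e) * (q + e) = c * p * q + e * (c * (p + q + e)) by ring.
rewrite ceq -ltrBrDl -/d.
have eK' : e * (c * (p + q + e)) <= e * K.
  by rewrite ler_pM2l // ler_pM2l // lerD2l.
have eK0 : 0 < e * K by rewrite mulr_gt0.
lra.
Qed.

(** An operator norm [t] that is to be divided by may be zero; it is replaced by a
positive [a] that is slightly larger if necessary. When [t] and [k] are both
zero the powers agree for every [a]. *)
Lemma exists_gt0_exp_le (t p e : R) k : 0 <= t -> 0 <= p -> 0 < e ->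
  exists a, [/\ 0 < a, t <= a & p * a ^+ k <= p * t ^+ k + e].
Proof.
move=> t0 p0 e0; have [tp|] := ltrP 0 t.
  by exists t; split=> //; rewrite lerDl ltW.
move=> t_le0; have {t0 t_le0}-> : t = 0 by apply/eqP; rewrite eq_le t_le0.
case: k => [|k].
  by exists 1; split; rewrite ?ltr01 ?ler01 // !expr0 lerDl ltW.
have p1 : 0 < p + 1 by rewrite ltr_wpDl.
have ep : 0 < e / (p + 1) by rewrite divr_gt0.
pose a := Num.min 1 (e / (p + 1)).
have a0 : 0 < a by rewrite lt_min ltr01 ep.
have a1 : a <= 1 by rewrite ge_min lexx.
have aep : a <= e / (p + 1) by rewrite ge_min lexx orbT.
have ae : a * (p + 1) <= e by rewrite -ler_pdivlMr.
exists a; split=> //; first exact: ltW.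
rewrite expr0n mulr0 add0r exprS.
have ak : a * a ^+ k <= a by apply: ler_piMr; [|apply: exprn_ile1 => //]; exact: ltW.
apply: le_trans (ler_wpM2l p0 ak) _.
by rewrite (le_trans _ ae) // mulrC ler_pM2l // lerDl.
Qed.

End RealEstimates.

(** * The three implications *)

Section Implications.
Variables (R : realType) (alpha : forall k : nat, tensor_norm_fun R k).
Arguments alpha _ _ _ : clear implicits.
Hypothesis alpha_norm : forall k, is_symmetric_tensor_norm (alpha k).
Variables (k l : nat) (c : R).
Hypothesis c_gt0 : 0 < c.

Definition maximal_product (E : normedModType R[i]) := forall P Q : E -> R[i]^o,
  max_ideal (alpha k) P -> max_ideal (alpha l) Q ->
  max_ideal (alpha (k + l)%N) (fun x => P x * Q x) /\
  (max_norm (alpha (k + l)%N) (fun x => P x * Q x)%R <=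
    c%:E * max_norm (alpha k) P * max_norm (alpha l) Q)%E.

Definition minimal_product (E : normedModType R[i]) := forall P Q : E -> R[i]^o,
  min_ideal (alpha k) P -> min_ideal (alpha l) Q ->
  min_ideal (alpha (k + l)%N) (fun x => P x * Q x) /\
  (min_norm (alpha (k + l)%N) (fun x => P x * Q x)%R <=
    c%:E * min_norm (alpha k) P * min_norm (alpha l) Q)%E.

Definition tensor_product_bound (E : normedModType R[i]) :=
  forall (s : tensor k (dual E)) (t : tensor l (dual E)),
  symmetric_tensors s -> symmetric_tensors t ->
  alpha (k + l)%N _ (symmetrization (tensor_mul s t)) <=
    c * alpha k _ s * alpha l _ t.

Lemma poly_of_symmetric_product (E : normedModType R[i])
    (s : tensor k (dual E)) (t : tensor l (dual E)) :
  poly_of_tensor (symmetrization (tensor_mul s t)) =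
  fun x => poly_of_tensor s x * poly_of_tensor t x.
Proof.
rewrite poly_of_symmetrization; apply/funext => x; exact: poly_of_tensor_mul.
Qed.

Lemma tensor_product_bound_maximal (E : normedModType R[i]) :
  (forall N : submodClosed E, finite_dim N -> tensor_product_bound (lsubspace N)) ->
  maximal_product E.
Proof.
move=> bound P Q mP mQ.
have le_PQ : (max_norm (alpha (k + l)%N) (fun x => P x * Q x)%R <=
    c%:E * max_norm (alpha k) P * max_norm (alpha l) Q)%E.
  apply: max_norm_le => N fN; have cN := finite_dim_coordinates fN.
  have sP := symmetric_tensor_of_poly k (P \o inclusion N).
  have sQ := symmetric_tensor_of_poly l (Q \o inclusion N).
  have PE := tensor_of_polyK cN (homogeneous_comp (inclusion N) mP.1).
  have QE := tensor_of_polyK cN (homogeneous_comp (inclusion N) mQ.1).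
  rewrite (poly_of_tensorK (u := symmetrization (tensor_mul
    (tensor_of_poly k (P \o inclusion N)) (tensor_of_poly l (Q \o inclusion N))))) //.
  - apply: (@le_trans _ _ (c * alpha k _ (tensor_of_poly k (P \o inclusion N)) *
      alpha l _ (tensor_of_poly l (Q \o inclusion N)))%:E).
      by rewrite lee_fin; exact: bound.
    rewrite !EFinM lee_pmul ?mule_ge0 ?lee_fin ?(ltW c_gt0) ?tensor_norm_ge0 //.
      by rewrite lee_wpmul2l ?lee_fin ?(ltW c_gt0) // le_max_norm.
    exact: le_max_norm.
  - exact: symmetric_symmetrization.
  - by rewrite poly_of_symmetric_product PE QE.
split=> //; split; first exact: homogeneous_mul mP.1 mQ.1.
apply: le_lt_trans le_PQ _.
rewrite -(fineK (max_norm_fin (alpha_norm k) mP)).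
by rewrite -(fineK (max_norm_fin (alpha_norm l) mQ)) -!EFinM ltry.
Qed.

(** Through the operator [T = (T1 / a, T2 / b)] of norm at most 1, the product is the
composite of [T] and the product of the polynomials [P1] of [a] times the first
coordinate and [Q1] of [b] times the second one. The factors [a ^+ k] and
[b ^+ l] come from the norms of these scaled projections. Scaling is needed
because a common bound for [T1] and [T2] would appear to the power [k + l]. *)
Lemma min_factorization_product (E : normedModType R[i])
    (E1 E2 : completeNormedModType R[i]) (T1 : blinop E E1) (T2 : blinop E E2)
    (P : E -> R[i]^o) (Q : E -> R[i]^o) (P1 : E1 -> R[i]^o) (Q1 : E2 -> R[i]^o)
    (a b : R) :
  maximal_product (E1 * E2)%type ->
  min_factorization (alpha k) P T1 P1 -> min_factorization (alpha l) Q T2 Q1 ->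
  0 < a -> rnorm T1 <= a -> 0 < b -> rnorm T2 <= b ->
  min_ideal (alpha (k + l)%N) (fun x => P x * Q x) /\
  (min_norm (alpha (k + l)%N) (fun x => P x * Q x)%R <=
    (c * (fine (max_norm (alpha k) P1) * a ^+ k) *
     (fine (max_norm (alpha l) Q1) * b ^+ l))%:E)%E.
Proof.
move=> prodm [aT1 mP1 PE] [aT2 mQ1 QE] a0 T1a b0 T2b.
have rnormC (x : R) : 0 <= x -> rnorm (x%:C : R[i]^o) = x.
  by move=> x0; rewrite /rnorm ger0_norm // lecR.
have aC : a%:C != 0 :> R[i] by rewrite (inj_eq (@complexI R)) gt_eqF.
have bC : b%:C != 0 :> R[i] by rewrite (inj_eq (@complexI R)) gt_eqF.
have scaleVK (V : lmodType R[i]) (x : R) (v : V) :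
    x != 0 -> v = x%:C *: (x^-1%:C *: v).
  by move=> x0; rewrite scalerA -rmorphM mulfV // scale1r.
have contraction (F : normedModType R[i]) (T : blinop E F) (x : R) :
    0 < x -> rnorm T <= x -> rnorm (x^-1%:C *: T) <= 1.
  move=> x0 Tx; rewrite (rnormZ (x^-1%:C)) rnormC ?invr_ge0 ?(ltW x0) //.
  by rewrite ler_pdivrMl // mulr1.
have cE12 := @prod_complete _ E1 E2 (@cauchy_cvg E1) (@cauchy_cvg E2).
pose T := pair_blinop (a^-1%:C *: T1) (b^-1%:C *: T2).
have T1' : rnorm T <= 1.
  by apply: le_trans (rnorm_pair_blinop _ _) _; rewrite ge_max !contraction.
have aT : approximable T by apply: approximable_pair; exact: approximableZ.
pose A : blinop (E1 * E2)%type E1 := a%:C *: fst_blinop E1 E2.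
pose B : blinop (E1 * E2)%type E2 := b%:C *: snd_blinop E1 E2.
have Aa : rnorm A <= a.
  by rewrite (rnormZ a%:C) rnormC ?(ltW a0) // ler_piMr ?(ltW a0) ?rnorm_fst_blinop.
have Bb : rnorm B <= b.
  by rewrite (rnormZ b%:C) rnormC ?(ltW b0) // ler_piMr ?(ltW b0) ?rnorm_snd_blinop.
have [mAB le_AB] := prodm _ _ (max_ideal_comp (alpha_norm k) A mP1)
  (max_ideal_comp (alpha_norm l) B mQ1).
have fT : (fun x => P x * Q x) = (fun z => (P1 \o A) z * (Q1 \o B) z) \o T.
  apply/funext => x; rewrite PE QE /=; congr (P1 _ * Q1 _).
    transitivity (a%:C *: (a^-1%:C *: T1 x)); last by [].
    exact: (scaleVK _ _ _ (lt0r_neq0 a0)).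
  transitivity (b%:C *: (b^-1%:C *: T2 x)); last by [].
  exact: (scaleVK _ _ _ (lt0r_neq0 b0)).
have bound : (max_norm (alpha (k + l)%N) (fun z => (P1 \o A) z * (Q1 \o B) z)%R <=
    (c * (fine (max_norm (alpha k) P1) * a ^+ k) *
     (fine (max_norm (alpha l) Q1) * b ^+ l))%:E)%E.
  apply: le_trans le_AB _; rewrite !EFinM.
  have le_comp m (G H : normedModType R[i]) (S : blinop G H) (U : H -> R[i]^o) x :
      max_ideal (alpha m) U -> rnorm S <= x ->
      (max_norm (alpha m) (U \o S) <= (fine (max_norm (alpha m) U) * x ^+ m)%R%:E)%E.
    move=> mU Sx; apply: le_trans (max_norm_comp (alpha_norm m) S mU) _.
    rewrite -{1}(fineK (max_norm_fin (alpha_norm m) mU)) -EFinM lee_fin.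
    rewrite ler_wpM2l ?fine_ge0 ?max_norm_ge0 // lerXn2r ?nnegrE ?rnorm_ge0 //.
    exact: le_trans (rnorm_ge0 _) Sx.
  rewrite lee_pmul ?mule_ge0 ?lee_fin ?(ltW c_gt0) ?max_norm_ge0 //.
    by rewrite lee_wpmul2l ?lee_fin ?(ltW c_gt0) // -EFinM le_comp.
  by rewrite -EFinM le_comp.
have [mPQ le_PQ] := min_ideal_contraction (alpha_norm _) cE12 aT T1' mAB.
rewrite fT; split=> //; exact: le_trans le_PQ bound.
Qed.

Lemma maximal_product_minimal (E : normedModType R[i]) :
  (forall E1 E2 : completeNormedModType R[i], maximal_product (E1 * E2)%type) ->
  minimal_product E.
Proof.
move=> prodm P Q mP mQ.
have factor m (U : E -> R[i]^o) (e : R) : min_ideal (alpha m) U -> 0 < e ->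
    exists (E1 : completeNormedModType R[i]) (T : blinop E E1) (U1 : E1 -> R[i]^o) (a : R),
    [/\ min_factorization (alpha m) U T U1, 0 < a, rnorm T <= a &
      fine (max_norm (alpha m) U1) * a ^+ m <= fine (min_norm (alpha m) U) + e].
  move=> mU e0; have e20 : 0 < e / 2 by rewrite divr_gt0.
  have min_fin := min_norm_fin (alpha_norm m) mU.
  have [_ [E1 [T [U1 [fact ->]]]] lt_e] := lb_ereal_inf_adherent e20 min_fin.
  have [_ mU1 _] := fact.
  have U1_ge0 : 0 <= fine (max_norm (alpha m) U1) by rewrite fine_ge0 ?max_norm_ge0.
  have [a [a0 Ta le_a]] := exists_gt0_exp_le m (rnorm_ge0 T) U1_ge0 e20.
  exists E1, T, U1, a; split=> //.
  apply: le_trans le_a _; rewrite [e in leRHS]splitr addrA lerD2r -lee_fin.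
  rewrite EFinM fineK ?(max_norm_fin (alpha_norm m) mU1) //.
  by rewrite EFinD fineK // ltW.
have approx e : 0 < e -> min_ideal (alpha (k + l)%N) (fun x => P x * Q x) /\
    (min_norm (alpha (k + l)%N) (fun x => P x * Q x)%R <=
     (c * (fine (min_norm (alpha k) P) + e) * (fine (min_norm (alpha l) Q) + e))%:E)%E.
  move=> e0.
  have [E1 [T1 [P1 [a [f1 a0 T1a le_a]]]]] := factor _ _ _ mP e0.
  have [E2 [T2 [Q1 [b [f2 b0 T2b le_b]]]]] := factor _ _ _ mQ e0.
  have [mPQ le_PQ] := min_factorization_product (prodm E1 E2) f1 f2 a0 T1a b0 T2b.
  split=> //; apply: le_trans le_PQ _; rewrite lee_fin.
  have max_ge0 m (G : normedModType R[i]) (U : G -> R[i]^o) x :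
      0 < x -> 0 <= fine (max_norm (alpha m) U) * x ^+ m.
    by move=> x0; rewrite mulr_ge0 ?fine_ge0 ?max_norm_ge0 ?exprn_ge0 // ltW.
  apply: ler_pM; rewrite ?max_ge0 // ?ler_pM2l //.
  by rewrite mulr_ge0 ?max_ge0 // ltW.
have [mPQ _] := approx 1 ltr01; split=> //.
have PQ_fin := min_norm_fin (alpha_norm _) mPQ.
rewrite -(fineK PQ_fin) -(fineK (min_norm_fin (alpha_norm k) mP)).
rewrite -(fineK (min_norm_fin (alpha_norm l) mQ)) -!EFinM lee_fin.
apply: le_mul_adherent; rewrite ?fine_ge0 ?min_norm_ge0 // => e e0.
by rewrite -lee_fin fineK //; have [] := approx e e0.
Qed.

(** On a finite dimensional space the minimal norm of the polynomial of a symmetric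
tensor is the tensor norm, so that the bound on products of polynomials is a
bound on tensors. *)
Lemma minimal_product_finite_dim (E : normedModType R[i]) : has_coordinates E ->
  minimal_product E -> tensor_product_bound E.
Proof.
move=> cE prodm s t ss st.
have [mP le_P] := min_ideal_finite_dim (alpha_norm k) cE
  (max_ideal_poly_of_tensor (alpha_norm k) ss).
have [mQ le_Q] := min_ideal_finite_dim (alpha_norm l) cE
  (max_ideal_poly_of_tensor (alpha_norm l) st).
have [_ le_PQ] := prodm _ _ mP mQ.
rewrite -lee_fin.
apply: le_trans (tensor_norm_le_max_norm (alpha_norm _) cE (symmetric_symmetrization _)) _.
rewrite poly_of_symmetric_product.
apply: le_trans (max_norm_le_min_norm (alpha_norm _) _) _.
apply: le_trans le_PQ _; rewrite !EFinM.
rewrite lee_pmul ?mule_ge0 ?lee_fin ?(ltW c_gt0) ?min_norm_ge0 //.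
  rewrite lee_wpmul2l ?lee_fin ?(ltW c_gt0) //.
  exact: le_trans le_P (max_norm_poly_of_tensor (alpha_norm k) ss).
exact: le_trans le_Q (max_norm_poly_of_tensor (alpha_norm l) st).
Qed.

(** The inclusion [M -> E'] is [adjoint r \o J], where [J] embeds [M] into its
bidual and [r : E -> M'] restricts the evaluations at points of [E] to [M].
Both operators are contractions, so that passing through the bidual of [M]
does not increase tensor norms. *)
Lemma tensor_product_bound_bidual (E : normedModType R[i]) :
  (forall k, finitely_generated (alpha k)) ->
  (forall N : submodClosed (dual E), finite_dim N ->
    tensor_product_bound (dual (lsubspace N))) ->
  tensor_product_bound E.
Proof.
move=> alpha_fg bound s t ss st.
apply: le_mul_adherent; rewrite ?tensor_norm_ge0 // => e e0.
have [N1 [s1 [[n1 [v1 Nv1]] ss1 s1E lt_s]]] :=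
  finitely_generated_approx (alpha_norm k) (alpha_fg k) ss e0.
have [N2 [t2 [[n2 [v2 Nv2]] st2 t2E lt_t]]] :=
  finitely_generated_approx (alpha_norm l) (alpha_fg l) st e0.
pose v i := match fintype.split i with inl j => v1 j | inr j => v2 j end.
pose M := span_subspace v.
have lspan_incl n (w : 'I_n -> dual E) : (forall i, exists j, w i = v j) ->
    forall x, lspan (range w) x -> x \in M.
  move=> wv x /lspan_rangeP[d ->]; apply/in_span; apply: lspan_sum => i _.
  by apply: lspanZ; have [j ->] := wv i; apply: lspan_gen; exists j.
have N1M x : inclusion N1 x \in M.
  apply: (lspan_incl _ v1) => [i|]; last by apply: Nv1; exact: valP.
  by exists (lshift n2 i); rewrite /v -/(unsplit (inl i)) unsplitK.
have N2M x : inclusion N2 x \in M.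
  apply: (lspan_incl _ v2) => [i|]; last by apply: Nv2; exact: valP.
  by exists (rshift n1 i); rewrite /v -/(unsplit (inr i)) unsplitK.
pose J := bidual_embedding (lsubspace M).
pose r : blinop E (dual (lsubspace M)) :=
  comp_blinop (adjoint (inclusion M)) (bidual_embedding E).
have r1 : rnorm (adjoint r) <= 1.
  apply: le_trans (rnorm_adjoint _) (le_trans (rnorm_comp_blinop _ _) _).
  rewrite -[leRHS]mulr1 ler_pM ?rnorm_ge0 ?rnorm_bidual_embedding //.
  exact: le_trans (rnorm_adjoint _) (rnorm_inclusion _).
have rJ g : adjoint r (J g) = inclusion M g by exact: blinop_eq.
have lift m (N : submodClosed (dual E)) (NM : forall x, inclusion N x \in M)
    (u : tensor m (lsubspace N)) : symmetric_tensors u ->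
    let u' := tensor_map J (tensor_map (corestrict NM) u) in
    [/\ symmetric_tensors u', alpha m _ u' <= alpha m _ u &
      tensor_map (adjoint r) u' = tensor_map (inclusion N) u].
  move=> su u'; have su1 := symmetric_tensor_map (corestrict NM) su.
  split; first exact: symmetric_tensor_map.
    apply: le_trans (tensor_norm_contraction (alpha_norm m) (rnorm_bidual_embedding _) su1) _.
    apply: tensor_norm_contraction su => //.
    exact: le_trans (rnorm_corestrict _) (rnorm_inclusion _).
  rewrite (tensor_map_comp (U := inclusion M)) //.
  exact: tensor_map_comp.
have [ss' le_s sE] := lift _ _ N1M _ ss1.
have [st' le_t tE] := lift _ _ N2M _ st2.
rewrite -{1}s1E -{1}t2E -sE -tE -tensor_map_mul -tensor_map_symmetrization.
apply: le_trans (tensor_norm_contraction (alpha_norm _) r1 (symmetric_symmetrization _)) _.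
apply: le_trans (bound _ (finite_dim_span _) _ _ ss' st') _.
have le_s' := le_trans le_s (ltW lt_s); have le_t' := le_trans le_t (ltW lt_t).
apply: ler_pM; rewrite ?tensor_norm_ge0 // ?ler_pM2l //.
by rewrite mulr_ge0 ?tensor_norm_ge0 // ltW.
Qed.

End Implications.

Theorem proposition2p6 (R : realType)
    (alpha : forall k : nat, tensor_norm_fun R k)
    (alpha_norm : forall k : nat, is_symmetric_tensor_norm (alpha k))
    (alpha_fg : forall k : nat, finitely_generated (alpha k))
    (k l : nat) (c : R) (c_gt0 : 0 < c) :
  [<->
    forall (E : completeNormedModType R[i]) (P Q : E -> R[i]^o),
      max_ideal (alpha k) P -> max_ideal (alpha l) Q ->
      max_ideal (alpha (k + l)%N) (fun x => P x * Q x) /\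
      (max_norm (alpha (k + l)%N) (fun x => P x * Q x)%R <=
        c%:E * max_norm (alpha k) P * max_norm (alpha l) Q)%E;
    forall (E : completeNormedModType R[i]) (P Q : E -> R[i]^o),
      min_ideal (alpha k) P -> min_ideal (alpha l) Q ->
      min_ideal (alpha (k + l)%N) (fun x => P x * Q x) /\
      (min_norm (alpha (k + l)%N) (fun x => P x * Q x)%R <=
        c%:E * min_norm (alpha k) P * min_norm (alpha l) Q)%E;
    forall (E : completeNormedModType R[i])
           (s : tensor k (dual E)) (t : tensor l (dual E)),
      symmetric_tensors s -> symmetric_tensors t ->
      alpha (k + l)%N (dual E) (symmetrization (tensor_mul s t)) <=
        c * alpha k (dual E) s * alpha l (dual E) t ].
Proof.
tfae => [maxP E|minP E|tensP E].
- apply: maximal_product_minimal => // E1 E2.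
  have [F ->] := banachP (@prod_complete _ E1 E2 (@cauchy_cvg E1) (@cauchy_cvg E2)).
  exact: maxP.
- apply: tensor_product_bound_bidual => // N fN.
  have cN := has_coordinates_dual (finite_dim_coordinates fN).
  apply: minimal_product_finite_dim => //.
  have [F ->] := banachP (has_coordinates_complete cN).
  exact: minP.
- apply: tensor_product_bound_maximal => // N fN.
  have [F ->] := banachP (has_coordinates_complete (finite_dim_coordinates fN)).
  exact: tensP.
Qed.
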